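(* For all integers $m,n\ge3$ there is a dense open subset $U_{m,n}$ of $R_{2,m}\times R'_{2,n}$ such that for every $(M,M')\in U_{m,n}$, every vertex map $f:P(M)\to Q(M')$ of rank two is a simple vertex of the polytope $\mathrm{Hom}(P(M),Q(M'))$.
   Context: For a real $2\times m$ matrix $M$, $P(M)\subset\mathbb{R}^2$ is the convex hull of the columns of $M$; $R_{2,m}\subset\mathbb{R}^{2\times m}$ is the (open, semi-algebraic) set of matrices $M$ for which $P(M)$ is a polygon (2-dimensional) with exactly $m$ vertices. For a real $n\times 2$ matrix $M'$, $Q(M')=\{x\in\mathbb{R}^2: M'x\le\mathbf{1}\}$ with $\mathbf{1}$ the all-ones vector; $R'_{2,n}\subset\mathbb{R}^{n\times 2}$ is the set of $M'$ for which $Q(M')$ is a polygon with exactly $n$ edges. $\mathrm{Hom}(P,Q)$ is the set of affine maps $P\to Q$, a 6-dimensional convex polytope in the space of affine maps $\mathbb{R}^2\to\mathbb{R}^2$; a vertex map is a vertex of it, its rank is $\dim f(P)$, and a vertex of a $6$-dimensional polytope is simple if it lies in exactly $6$ facets. *)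

(* Defs.v *)
From HB Require Import structures.
From mathcomp Require Import all_boot all_order all_algebra.
From mathcomp Require Import all_classical all_reals all_analysis.

Set Implicit Arguments.
Unset Strict Implicit.
Unset Printing Implicit Defensive.

Import Order.TTheory GRing.Theory Num.Theory.
Import numFieldNormedType.Exports.

Local Open Scope classical_set_scope.
Local Open Scope ring_scope.
Local Open Scope card_scope.

Section Polytopes.
Variables (R : realType) (V : vectType R).
Implicit Types (S K F : set V) (v : V) (d : nat).

Definition conv_hull S : set V := smallest (@convex_set R V) S.

Definition is_polytope K : Prop := exists2 S, finite_set S & K = conv_hull S.

(* The points x0, x0 + s_0, ..., x0 + s_(d-1) are an affine basis of the affine
   hull of K, chosen inside K. The empty set has no dimension in this sense. *)
Definition has_dim K d : Prop :=
  exists x0 (s : d.-tuple V),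
    [/\ K x0, free s, (forall i, K (x0 + tnth s i)) &
        forall x, K x -> x - x0 \in span s].

(* The choice l = 0 makes K itself and the empty set faces of K. *)
Definition is_face K F : Prop :=
  exists (l : {scalar V}) (c : R),
    (forall x, K x -> l x <= c) /\ F = [set x | K x /\ l x = c].

Definition is_vertex K v : Prop := is_face K [set v].

Definition is_edge K F : Prop := is_face K F /\ has_dim F 1.

Definition is_facet K F : Prop :=
  is_face K F /\ exists2 d, has_dim K d.+1 & has_dim F d.

Definition is_polygon K : Prop := is_polytope K /\ has_dim K 2.

Definition simple_vertex d K v : Prop :=
  [/\ has_dim K d, is_vertex K v & [set F | is_facet K F /\ F v] #= `I_d].

End Polytopes.

Section HomPolytope.
Variable R : realType.

Definition Ppoly m (M : 'M[R]_(2, m)) : set 'cV[R]_2 :=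
  conv_hull (range (fun j => col j M)).

Definition Qpoly n (M' : 'M[R]_(n, 2)) : set 'cV[R]_2 :=
  [set x | forall i, (M' *m x) i 0 <= 1].

Definition R2 m : set 'M[R]_(2, m) :=
  [set M | is_polygon (Ppoly M) /\ [set v | is_vertex (Ppoly M) v] #= `I_m].

Definition R2' n : set 'M[R]_(n, 2) :=
  [set M' | is_polygon (Qpoly M') /\ [set F | is_edge (Qpoly M') F] #= `I_n].

(* The pair (A, b) is the affine map x |-> A x + b; this is the 6-dimensional
   vector space of affine maps from R^2 to R^2. *)
Definition affmap : vectType R := ('M[R]_(2, 2) * 'cV[R]_2)%type.

Definition affmap_fun (f : affmap) (x : 'cV[R]_2) : 'cV[R]_2 := f.1 *m x + f.2.

(* An affine map defined on a 2-dimensional P extends uniquely to R^2, so maps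
   P -> Q are identified with affine maps of the plane sending P into Q. *)
Definition aff_hom (P Q : set 'cV[R]_2) : set affmap :=
  [set f | affmap_fun f @` P `<=` Q].

Definition vertex_map (P Q : set 'cV[R]_2) (f : affmap) : Prop :=
  is_vertex (aff_hom P Q) f.

Definition map_rank (P : set 'cV[R]_2) (f : affmap) (r : nat) : Prop :=
  has_dim (affmap_fun f @` P) r.

End HomPolytope.

(* Openness and density are relative to the subspace topology of D. *)
Definition dense_open_subset (T : topologicalType) (D U : set T) : Prop :=
  [/\ U `<=` D, (exists2 O, open O & U = D `&` O) & D `<=` closure U].

(* Main.v *)
Require Import Defs.
From HB Require Import structures.
From mathcomp Require Import all_boot all_order all_algebra.
From mathcomp Require Import all_classical all_reals all_analysis.
From mathcomp Require Import finmap ring lra.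

Set Implicit Arguments.
Unset Strict Implicit.
Unset Printing Implicit Defensive.

Import Order.TTheory GRing.Theory Num.Theory.
Import numFieldNormedType.Exports.
Import VectorInternalTheory.

Local Open Scope classical_set_scope.
Local Open Scope ring_scope.
Local Open Scope card_scope.

(* Let x_j be the columns of M and a_i the rows of M'. Then Hom(P(M), Q(M')) is
   the polyhedron of the affine maps f = (A, b) with a_i (A x_j + b) <= 1 for
   all i, j, and a vertex f is simple as soon as the inequalities that are tight
   at f are linearly independent.

   Let w_ij be the coefficient vector of the affine function
   f |-> a_i (A x_j + b) - 1. Call (M, M') generic if every set T of pairs (i, j)
   whose vectors w_ij are independent for some pair of matrices has independent
   vectors at (M, M'). A nonzero Gram determinant expresses independence, so the
   generic pairs form a dense open set; R_{2,m} and R'_{2,n} are open.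

   At a generic pair, suppose that f is invertible and that T is a minimal
   dependent set of tight incidences. As all w_ij in T vanish at f, T has at most
   7 elements. If some j occurred in only one pair (i, j) of T, moving x_j to the
   zero of f would keep T dependent (by genericity), which is impossible because
   (i, j) is now the only incidence of T that fails at f. So every j occurs at
   least twice, at most three columns x_j occur, and these are affinely
   independent. Hence the relation splits into relations sum_i c_ij a_i = 0, one
   for each j; at most two lines a_i y = 1 pass through f(x_j), and two of them
   have independent a_i, a contradiction. *)

(** * Counting and finite minima *)

Lemma card_eq_range_ord (T : Type) k (g : 'I_k -> T) :
  injective g -> range g #= `I_k.
Proof.
move=> ginj; apply: (@card_eq_trans _ _ _ _ [set: 'I_k]).
  by apply: inj_card_eq => x y _ _; exact: ginj.
by rewrite card_eq_sym; exact: card_II.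
Qed.

(** A set of [k] elements inside the range of [k] indices leaves no room for repetition or surplus.
    This turns the number of vertices or edges into a statement about each column or row. *)
Lemma eq_range_ord (T : choiceType) k (g : 'I_k -> T) (A : set T) :
  A #= `I_k -> A `<=` range g -> injective g /\ A = range g.
Proof.
move=> Ak Ag.
have rE : range g = [set` codom g].
  apply/seteqP; split => [x [i _ <-]|x /=]; first exact: codom_f.
  by case/codomP => i ->; exists i.
have fA : finite_set A.
  by apply: (sub_finite_set Ag); rewrite rE; exact: finite_seq.
have cA : size (fset_set A) = k by rewrite (card_fset_set Ak).
have sub : {subset (fset_set A : seq T) <= codom g}.
  move=> x; rewrite in_fset_set// => /set_mem/Ag [i _ <-]; exact: codom_f.
have sz : (size (codom g) <= size (fset_set A))%N.
  by rewrite size_codom card_ord cA.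
have uA : uniq (fset_set A) by exact: fset_uniq.
have [_ mE] := uniq_min_size uA sub sz.
split; last first.
  rewrite rE; apply/seteqP; split => x /=.
    by move=> Ax; apply: sub; rewrite in_fset_set//; exact: mem_set.
  by rewrite -mE in_fset_set// => /set_mem.
have : uniq (codom g) by rewrite (leq_size_uniq uA sub sz).
by move=> ?; exact/injectiveP.
Qed.

Lemma ex_common_threshold (R : realType) (I : finType) (P : I -> R -> Prop) :
  (forall i, exists2 t, 0 < t & forall s, 0 <= s <= t -> P i s) ->
  exists2 t, 0 < t & forall i s, 0 <= s <= t -> P i s.
Proof.
move=> H; have H' i : exists t, 0 < t /\ forall s, 0 <= s <= t -> P i s.
  by have [t t0 h] := H i; exists t.
have [t /all_and2[t0 ht]] := choice H'.
exists (\big[Num.min/1]_i t i); first exact: lt_bigmin.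
move=> i s /andP[s0 st]; apply: ht; rewrite s0/=.
exact: le_trans st (bigmin_le _ _ _).
Qed.

(** * Dimension and direction spaces *)

Section HasDim.
Variables (R : realType) (V : vectType R).
Implicit Types K F : set V.

Lemma has_dim_span_sub K K' d d' x0 x1 (s : d.-tuple V) (t : d'.-tuple V) :
  (forall x, K' x -> x - x1 \in span t) -> K `<=` K' ->
  K x0 -> (forall i, K (x0 + tnth s i)) -> (span s <= span t)%VS.
Proof.
move=> ht KK' Kx0 Ks; apply/span_subvP => v /tnthP[i ->].
have -> : tnth s i = (x0 + tnth s i - x1) - (x0 - x1).
  by rewrite opprB addrA subrK addrAC subrr add0r.
by apply: rpredB; apply: ht; apply: KK'.
Qed.

Lemma has_dim_le K K' d d' : K `<=` K' -> has_dim K d -> has_dim K' d' ->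
  (d <= d')%N.
Proof.
move=> KK' [x0 [s [Kx0 fs Ks hs]]] [x1 [t [Kx1 ft Kt ht]]].
have := dimvS (has_dim_span_sub ht KK' Kx0 Ks).
by move: fs ft; rewrite /free !size_tuple => /eqP-> /eqP->.
Qed.

Lemma has_dim_uniq K d d' : has_dim K d -> has_dim K d' -> d = d'.
Proof.
move=> h h'; apply/eqP; rewrite eqn_leq.
by rewrite (has_dim_le (@subset_refl _ K) h h') (has_dim_le (@subset_refl _ K) h' h).
Qed.

(** The form that cuts out [F] is constant on its affine hull, and equal dimensions give [F'] the
    same affine hull. *)
Lemma face_eq_dim K F F' d : is_face K F -> F `<=` F' -> F' `<=` K ->
  has_dim F d -> has_dim F' d -> F = F'.
Proof.
move=> [l [c [_ FE]]] FF' F'K [x0 [s [Fx0 fs Fs hs]]] [x1 [t [Kx1 ft Kt ht]]].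
apply/seteqP; split => // x F'x.
have st := has_dim_span_sub ht FF' Fx0 Fs.
have ts : (span t <= span s)%VS.
  have := dimv_leqif_sup st; move: fs ft; rewrite /free !size_tuple.
  by move=> /eqP-> /eqP-> [_]; rewrite eqxx => <-.
have xs : x - x0 \in span s.
  have -> : x - x0 = (x - x1) - (x0 - x1) by rewrite opprB addrA subrK.
  apply: rpredB.
    by apply: (subvP ts); apply: ht.
  by apply: (subvP ts); apply: ht; exact: FF'.
have lx0 : l x0 = c by move: Fx0; rewrite FE => -[].
have ls i : l (tnth s i) = 0.
  have : l (x0 + tnth s i) = c by have := Fs i; rewrite FE => -[].
  by rewrite raddfD/= lx0 => /eqP; rewrite -subr_eq0 addrC addKr => /eqP.
rewrite FE; split; first exact: F'K.
have : l (x - x0) = 0.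
  rewrite (coord_span xs) raddf_sum/= big1// => i _.
  by rewrite linearZ/= -tnth_nth ls mulr0.
by rewrite raddfB/= lx0 => /eqP; rewrite subr_eq0 => /eqP.
Qed.

End HasDim.

(** * Simple vertices of H-polyhedra *)

Section HPolyhedron.
Variables (R : realType) (V : vectType R) (I : finType) (l : I -> {scalar V}).

Definition hpoly : set V := [set x | forall i, l i x <= 1].

(** Slack constraints tolerate a small move in any direction; only the tight ones restrict [d]. *)
Lemma hpoly_step x d : hpoly x -> (forall i, l i x = 1 -> l i d <= 0) ->
  exists2 t, 0 < t & hpoly (x + t *: d).
Proof.
move=> Kx Kd.
have [i|t t0 ht] := @ex_common_threshold R I (fun i s => l i (x + s *: d) <= 1).
  have lE s : l i (x + s *: d) = l i x + s * l i d by rewrite linearD linearZ.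
  have [lx1|lx1] := eqVneq (l i x) 1.
    exists 1 => // s /andP[s0 _]; rewrite lE lx1 gerDl.
    by rewrite mulr_ge0_le0// Kd.
  have lx : 0 < 1 - l i x by rewrite subr_gt0 lt_neqAle lx1 Kx.
  have n0 : 0 < 1 + `|l i d| by rewrite ltr_pwDl.
  exists ((1 - l i x) / (1 + `|l i d|)); first exact: divr_gt0.
  move=> s /andP[s0]; rewrite ler_pdivlMr// => h.
  rewrite lE -lerBrDl (le_trans _ h)// ler_wpM2l//.
  by rewrite (le_trans (ler_norm _))// lerDr.
by exists t => // i; apply: ht; rewrite lexx ltW.
Qed.

(** A short move along [d] or [- d] stays inside, so the exposing form [g] vanishes at [d] and the
    face [[set f]] contains [f + t *: d] for some positive [t]. *)
Lemma hpoly_vertex_kernel f d : is_vertex hpoly f ->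
  (forall i, l i f = 1 -> l i d = 0) -> d = 0.
Proof.
move=> [g [c [gc fE]]] hd.
have Ff : [set f] f by [].
rewrite fE/= in Ff; case: Ff => Kf gf.
have [t t0 Kt] : exists2 t, 0 < t & hpoly (f + t *: d).
  by apply: hpoly_step => // i /hd ->.
have [u u0 Ku] : exists2 t, 0 < t & hpoly (f + t *: (- d)).
  by apply: hpoly_step => // i /hd; rewrite linearN => ->; rewrite oppr0.
have gd : g d = 0.
  apply/eqP; rewrite eq_le; apply/andP; split.
    by move: (gc _ Kt); rewrite linearD linearZ/= gf gerDl pmulr_rle0.
  by move: (gc _ Ku); rewrite linearD linearZ/= gf gerDl pmulr_rle0// linearN/= oppr_le0.
have : [set f] (f + t *: d).
  by rewrite fE/=; split => //; rewrite linearD linearZ/= gd gf mulr0 addr0.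
rewrite /= => /eqP; rewrite -subr_eq0 addrC addKr scaler_eq0 gt_eqF//=.
by move=> /eqP.
Qed.

Section DualBasis.
Variables (k : nat) (e : 'I_k -> I).
Hypothesis e_ker : forall x, (forall a, l (e a) x = 0) -> x = 0.
Hypothesis e_indep : forall c : 'I_k -> R,
  (forall x, \sum_a c a * l (e a) x = 0) -> forall a, c a = 0.

(** The columns of [L] are the forms in coordinates. [e_ker] makes its rows independent and
    [e_indep] its columns, so [L] is invertible and the rows of its inverse are the dual basis. *)
Lemma dual_basis : dim V = k /\
  exists d : 'I_k -> V, forall a b, l (e a) (d b) = (a == b)%:R.
Proof.
pose L : 'M[R]_(dim V, k) :=
  \matrix_(p, a) l (e a) (r2v (delta_mx 0 p : 'rV_(dim V))).
have LE x a : l (e a) x = (v2r x *m L) 0 a.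
  rewrite -{1}[x]v2rK {1}(row_sum_delta (v2r x)) linear_sum/= linear_sum/= mxE.
  by apply: eq_bigr => p _; rewrite !linearZ/= !mxE.
have Lfree : row_free L.
  apply: inj_row_free => u uL.
  rewrite -[u]r2vK (e_ker (x := r2v u)) ?linear0// => a.
  by rewrite LE r2vK uL mxE.
have Lfull : row_full L.
  rewrite /row_full -mxrank_tr; apply: (inj_row_free (A := L^T)) => u uL.
  apply/rowP => a; rewrite mxE; apply: (e_indep (c := fun a => u 0 a)) => x.
  have : (u *m L^T *m (v2r x)^T) 0 0 = 0 by rewrite uL mul0mx mxE.
  rewrite -mulmxA -trmx_mul mxE => hs; rewrite -[RHS]hs.
  by apply: eq_bigr => b _; rewrite LE [(_)^T _ _]mxE.
split; first by rewrite -(eqP Lfree) (eqP Lfull).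
exists (fun b => r2v (row b (pinvmx L))) => a b.
by rewrite LE r2vK -row_mul mulVpmx// !mxE eq_sym.
Qed.

End DualBasis.

Section SimpleVertex.
Variables (k : nat) (e : 'I_k -> I) (d : 'I_k -> V) (f : V).
Hypothesis e_tight : forall i, l i f = 1 <-> exists a, e a = i.
Hypothesis e_dual : forall a b, l (e a) (d b) = (a == b)%:R.
Hypothesis e_ker : forall x, (forall a, l (e a) x = 0) -> x = 0.
Hypothesis f_vertex : is_vertex hpoly f.

Let Kf : hpoly f.
Proof.
case: f_vertex => g [c [_ fE]].
by have : [set f] f by []; rewrite fE => -[].
Qed.

Let tight a : l (e a) f = 1. Proof. by apply/e_tight; exists a. Qed.

Let expand x : x = \sum_a l (e a) x *: d a.
Proof.
apply/eqP; rewrite -subr_eq0; apply/eqP/e_ker => a.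
rewrite linearB linear_sum/= (bigD1 a)//= linearZ/= e_dual eqxx mulr1 big1.
  by rewrite addr0 subrr.
by move=> b /negPf ba; rewrite linearZ/= e_dual eq_sym ba mulr0.
Qed.

Let step a : exists2 t, 0 < t & hpoly (f + t *: - d a).
Proof.
apply: hpoly_step => // i /e_tight[b <-].
by rewrite linearN/= e_dual oppr_le0 ler0n.
Qed.

Definition hfacet a : set V := [set x | hpoly x /\ l (e a) x = 1].

(* The points f - t_b d_b, one on each of the k edges leaving f, lie in every
   facet at f except the one dual to d_b. *)
Lemma has_dim_corner r (u : 'I_r -> 'I_k) (F : set V) : injective u ->
  (forall x, F x <-> hpoly x /\ forall a, a \notin codom u -> l (e a) x = 1) ->
  has_dim F r.
Proof.
move=> uinj FE.
have /choice[t ht] b : exists t, 0 < t /\ hpoly (f + t *: - d (u b)).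
  by have [t ? ?] := step (u b); exists t.
have t0 b : 0 < t b by case: (ht b).
have [s tE] : exists s : r.-tuple V, forall b, tnth s b = t b *: - d (u b).
  by exists [tuple t b *: - d (u b) | b < r] => b; rewrite tnth_mktuple.
exists f, s.
split.
- by apply/FE; split.
- apply/freeP => c hc b.
  have := congr1 (l (e (u b))) hc; rewrite linear0 linear_sum/= (bigD1 b)//= big1.
    rewrite addr0 -tnth_nth tE !linearZ/= linearN/= e_dual eqxx => /eqP.
    rewrite !mulf_eq0 (gt_eqF (t0 b))/= oppr_eq0 oner_eq0 orbF.
    by move=> /eqP.
  move=> b' b'b; rewrite -tnth_nth tE !linearZ/= linearN/= e_dual.
  by rewrite (inj_eq uinj) eq_sym (negPf b'b) oppr0 !mulr0.
- move=> b; rewrite tE; apply/FE; split; first by case: (ht b).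
  move=> a ub; rewrite linearD linearZ linearN/= e_dual tight.
  suff /negPf-> : a != u b by rewrite oppr0 mulr0 addr0.
  by apply: contraNneq ub => ->; exact: codom_f.
- move=> x /FE[Kx Fx]; rewrite (expand (x - f)); apply: rpred_sum => a _.
  have [/codomP[b ->]|na] := boolP (a \in codom u); last first.
    by rewrite linearB/= Fx// tight subrr scale0r rpred0.
  apply: rpredZ; have -> : d (u b) = - (t b)^-1 *: tnth s b.
    by rewrite tE !scalerN scaleNr opprK scalerA mulVf ?scale1r// gt_eqF.
  by apply: rpredZ; apply: memv_span; exact: mem_tnth.
Qed.

(** A form [g] cutting out a face through [f] is nonnegative on each [d a]. For a facet some
    [g (d a)] is positive, so constraint [e a] is tight on it, and equal dimensions make it
    [hfacet a]. *)
Lemma simple_vertex_of_dual : simple_vertex k hpoly f.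
Proof.
have Kdim : has_dim hpoly k.
  apply: (@has_dim_corner _ id) => // x; split=> [Kx|[]//]; split=> // a.
  by rewrite (_ : a \in codom id)// -[a]/(id a) codom_f.
split=> //.
have hfE a : [set F | is_facet hpoly F /\ F f] (hfacet a).
  split; last by split.
  split; first by exists (l (e a)), 1; split.
  have k0 : (0 < k)%N by apply: leq_ltn_trans (ltn_ord a).
  exists k.-1; first by rewrite prednK.
  (* [lift a] lists the indices other than [a]: the edges at [f] that stay in [hfacet a]. *)
  apply: (@has_dim_corner _ (lift a)) => [|x]; first exact: lift_inj.
  split=> [[Kx xa]|[Kx xa]]; split=> //.
    by move=> b; have [b' ->|->] := unliftP a b; rewrite ?codom_f.
  by apply: xa; apply/negP => /codomP[b /eqP]; rewrite (negPf (neq_lift _ _)).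
have -> : [set F | is_facet hpoly F /\ F f] = range hfacet.
  apply/seteqP; split=> [F [[Fface [r Kr Fr]] Ff]|_ [a _ <-]]; last exact: hfE.
  case: (Fface) => g [c [gc FE]].
  have gf : g f = c by move: Ff; rewrite FE => -[].
  have gd a : 0 <= g (d a).
    have [t t0 Kt] := step a.
    by have := gc _ Kt; rewrite linearD linearZ linearN/= gf gerDl mulrN oppr_le0 pmulr_rge0.
  have gE x : g x = \sum_a l (e a) x * g (d a).
    by rewrite {1}(expand x) linear_sum/=; apply: eq_bigr => a _; rewrite linearZ.
  have [a ga] : exists a, g (d a) != 0.
    apply: contrapT => /forallNP ga0.
    have g0 x : g x = 0.
      rewrite gE big1// => a _; have /negP := ga0 a.
      by rewrite negbK => /eqP ->; rewrite mulr0.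
    suff FK : F = hpoly by move: Fr; rewrite FK => /(has_dim_uniq Kr) /esym/n_Sn.
    by rewrite FE; apply/seteqP; split=> [x []//|x Kx]; split=> //; rewrite -gf !g0.
  exists a => //; apply/esym.
  have [[hface [r' Kr' hr']] _] := hfE a.
  have rr' : r' = r by apply: succn_inj; exact: has_dim_uniq Kr' Kr.
  apply: (face_eq_dim Fface _ _ Fr); last by rewrite -rr'.
    move=> x; rewrite FE => -[Kx gx]; split=> //.
    (* Nonnegative terms with zero sum vanish one by one; the factor [g (d a)] is nonzero, so
       constraint [e a] is tight at [x]. *)
    have : \sum_b (1 - l (e b) x) * g (d b) = 0.
      under eq_bigr do rewrite mulrBl mul1r.
      rewrite sumrB -gE gx -gf gE; apply/eqP; rewrite subr_eq0; apply/eqP.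
      by apply: eq_bigr => b _; rewrite tight mul1r.
    move/eqP; rewrite psumr_eq0; last first.
      by move=> b _; rewrite mulr_ge0// subr_ge0.
    move=> /allP/(_ a); rewrite mem_index_enum => /(_ isT)/=.
    by rewrite mulf_eq0 (negPf ga) orbF subr_eq0 => /eqP.
  by move=> x [].
apply: card_eq_range_ord => a b hab.
have [t t0 Kt] := step a.
apply/eqP; apply: contraT => /negPf ab.
have : hfacet b (f + t *: - d a).
  split=> //; rewrite linearD linearZ linearN/= e_dual tight.
  by rewrite eq_sym ab oppr0 mulr0 addr0.
rewrite -hab => -[_]; rewrite linearD linearZ linearN/= e_dual tight eqxx.
by move=> /eqP; rewrite -subr_eq0 addrC addKr mulrN1 oppr_eq0 gt_eqF.
Qed.

End SimpleVertex.
End HPolyhedron.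

(** * Convex hulls and the Minkowski-Weyl theorem *)

Section ConvexHull.
Variables (R : realType) (V : vectType R).
Implicit Types A S : set V.

Lemma convex_setP A : @convex_set R V A <->
  forall x y t, A x -> A y -> 0 <= t -> t <= 1 -> A (t *: x + (1 - t) *: y).
Proof.
split=> [cA x y t Ax Ay t0 t1|cA x y t /set_mem Ax /set_mem Ay].
  by have /set_mem := cA x y (Itv01 t0 t1) (mem_set Ax) (mem_set Ay).
by apply/mem_set; apply: cA.
Qed.

Lemma conv_hull_convex S x y t : conv_hull S x -> conv_hull S y ->
  0 <= t -> t <= 1 -> conv_hull S (t *: x + (1 - t) *: y).
Proof.
by move=> Sx Sy t0 t1 A [cA SA]; move/convex_setP: (cA); apply => //; [exact: Sx|exact: Sy].
Qed.

Lemma conv_hull_sub S A : @convex_set R V A -> S `<=` A -> conv_hull S `<=` A.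
Proof. by move=> cA SA; exact: smallest_sub. Qed.

Lemma sub_conv_hull S : S `<=` conv_hull S.
Proof. exact: sub_gen_smallest. Qed.

Lemma convex_halfspace (g : {scalar V}) c : @convex_set R V [set x | g x <= c].
Proof.
apply/convex_setP => x y t /= gx gy t0 t1; rewrite linearD !linearZ/=.
have -> : c = t * c + (1 - t) * c by ring.
by rewrite lerD// ler_wpM2l// subr_ge0.
Qed.

Lemma convex_open_halfspace (g : {scalar V}) c :
  @convex_set R V [set x | g x < c].
Proof.
apply/convex_setP => x y t /= gx gy t0 t1; rewrite linearD !linearZ/=.
have -> : c = t * c + (1 - t) * c by ring.
have [->|tN0] := eqVneq t 0; first by rewrite !mul0r !add0r subr0 !mul1r.
apply: ltr_leD; first by rewrite ltr_pM2l// lt_neqAle eq_sym tN0.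
by rewrite ler_wpM2l// ?subr_ge0// ltW.
Qed.

Lemma hpoly_convex (I : finType) (l : I -> {scalar V}) :
  @convex_set R V (hpoly l).
Proof.
apply/convex_setP => x y t Kx Ky t0 t1 i.
by have /convex_setP := @convex_halfspace (l i) 1; apply=> //; [exact: Kx|exact: Ky].
Qed.

End ConvexHull.

Section MinkowskiWeyl.
Variables (R : realType) (V : vectType R) (I : finType) (l : I -> {scalar V}).
Hypothesis no_recession : forall d, (forall i, l i d <= 0) -> d = 0.

Definition tight_set x : {set I} := [set i | l i x == 1].

(** The ratio test of linear programming: without recession directions some constraint grows along
    [d], and the first one reached becomes tight. *)
Lemma hpoly_exit x d : hpoly l x -> d != 0 ->
  (forall i, i \in tight_set x -> l i d = 0) ->
  exists t, [/\ 0 < t, hpoly l (x + t *: d) &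
    tight_set x \proper tight_set (x + t *: d)].
Proof.
move=> Kx d0 hd.
have [i0 i0d] : exists i, 0 < l i d.
  apply: contrapT => /forallNP h; case/eqP: d0; apply: no_recession => i.
  by rewrite leNgt; apply/negP.
have lE i t : l i (x + t *: d) = l i x + t * l i d by rewrite linearD linearZ.
case: (@arg_minP _ _ _ i0 (fun i => 0 < l i d) (fun i => (1 - l i x) / l i d) i0d).
move=> j jd jmin; exists ((1 - l j x) / l j d).
have t0 : 0 < (1 - l j x) / l j d.
  apply: divr_gt0 => //; rewrite subr_gt0 lt_neqAle Kx andbT.
  apply/negP => /eqP ljx; move: jd; rewrite hd ?ltxx//.
  by rewrite inE; apply/eqP.
split=> //.
  move=> i; rewrite lE; have [id|id] := ltP 0 (l i d).
    by rewrite -lerBrDl -ler_pdivlMr// jmin.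
  by rewrite (le_trans _ (Kx i))// gerDl mulr_ge0_le0// ltW.
apply/properP; split.
  by apply/fintype.subsetP => i xi; rewrite inE lE (hd i)// mulr0 addr0; move: xi; rewrite inE.
exists j; rewrite inE; last first.
  by apply/negP => ljx; move: jd; rewrite hd ?ltxx// inE.
by rewrite lE divfK ?(gt_eqF jd)// addrC subrK.
Qed.

(** The points of [S] are determined by their tight sets, hence finite in number. Any other point
    lies between two points with more tight constraints, so induction on the number of slack
    constraints applies. *)
Lemma hpoly_polytope : is_polytope (hpoly l).
Proof.
pose S := [set x | hpoly l x /\
  forall d, (forall i, i \in tight_set x -> l i d = 0) -> d = 0].
exists S.
  have inj : {in S &, injective tight_set}.
    move=> x y /set_mem[_ hx] /set_mem[_ _] xy; apply/eqP; rewrite -subr_eq0.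
    apply/eqP/hx => i ix; have := ix; rewrite xy.
    by move: ix; rewrite !inE linearB/= => /eqP-> /eqP->; rewrite subrr.
  by rewrite -(eq_finite_set (inj_card_eq inj)); exact: finite_finset.
apply/seteqP; split; last first.
  by apply: conv_hull_sub; [exact: hpoly_convex|move=> x []].
move=> x; move: {2}#|~: tight_set x|.+1 (ltnSn #|~: tight_set x|) => n.
elim: n x => // n IHn x xn Kx.
have [hx|] := pselect (forall d, (forall i, i \in tight_set x -> l i d = 0) -> d = 0).
  by apply: sub_conv_hull; split.
move=> /existsNP[d /not_implyP[hd /eqP d0]].
have dec y : hpoly l y -> tight_set x \proper tight_set y -> conv_hull S y.
  move=> Ky xy; apply: IHn => //.
  rewrite -ltnS (leq_trans _ xn)// ltnS; apply: proper_card.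
  move: xy; rewrite !finset.properEneq => /andP[xNy xy].
  by rewrite finset.setCS xy (inj_eq (can_inj finset.setCK)) eq_sym xNy.
have [t [t0 Kt /(dec _ Kt) St]] := hpoly_exit Kx d0 hd.
have [|i ix|u [u0 Ku /(dec _ Ku) Su]] := @hpoly_exit x (- d) Kx; rewrite ?oppr_eq0//.
  by rewrite linearN/= hd// oppr0.
have tu : 0 < t + u by rewrite addr_gt0.
have -> : x = (u / (t + u)) *: (x + t *: d) + (1 - u / (t + u)) *: (x + u *: - d).
  have -> : 1 - u / (t + u) = t / (t + u) by field; rewrite gt_eqF.
  rewrite !scalerDr addrACA -scalerDl -mulrDl [u + t]addrC divff ?gt_eqF// scale1r.
  rewrite !scalerN !scalerA -[LHS]addr0; congr (_ + _).
  by rewrite -scalerBl [X in X *: _](_ : _ = 0) ?scale0r//; ring.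
apply: conv_hull_convex => //.
  by rewrite divr_ge0// ltW.
by rewrite ler_pdivrMr// mul1r lerDr ltW.
Qed.

End MinkowskiWeyl.

(** * Polygons given by vertices *)

Section PlaneDuality.
Variable R : realType.

Definition dotp (p : 'rV[R]_2) (x : 'cV[R]_2) : R := (p *m x) 0 0.

Lemma dotpE p x : dotp p x = p 0 0 * x 0 0 + p 0 1 * x 1 0.
Proof.
rewrite /dotp mxE !big_ord_recl big_ord0 addr0.
by congr (_ + p _ _ * x _ _); apply/val_inj.
Qed.

Lemma dotp_is_scalar p : scalar (dotp p).
Proof. by move=> c x y; rewrite !dotpE !mxE; ring. Qed.

HB.instance Definition _ p :=
  GRing.isLinear.Build R 'cV[R]_2 R _ (dotp p) (dotp_is_scalar p).

Lemma cV2P (x y : 'cV[R]_2) : x 0 0 = y 0 0 -> x 1 0 = y 1 0 -> x = y.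
Proof.
move=> h0 h1; apply/colP; case=> [[|[|//]] i].
  by rewrite (_ : Ordinal i = 0)//; apply/val_inj.
by rewrite (_ : Ordinal i = 1)//; apply/val_inj.
Qed.

Lemma rV2P (x y : 'rV[R]_2) : x 0 0 = y 0 0 -> x 0 1 = y 0 1 -> x = y.
Proof.
move=> h0 h1; apply/rowP; case=> [[|[|//]] i].
  by rewrite (_ : Ordinal i = 0)//; apply/val_inj.
by rewrite (_ : Ordinal i = 1)//; apply/val_inj.
Qed.

Lemma scalar_dotp (g : {scalar 'cV[R]_2}) : exists p, forall x, g x = dotp p x.
Proof.
exists (\row_k g (delta_mx k 0)) => x.
have {1}-> : x = x 0 0 *: delta_mx 0 0 + x 1 0 *: delta_mx 1 0.
  by apply: cV2P; rewrite !mxE/= ?mulr1 ?mulr0 ?addr0 ?add0r.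
by rewrite linearD !linearZ/= dotpE !mxE; ring.
Qed.

(* If the determinant vanished, L u * L' v = L v * L' u would hold for all linear
   forms L, L' and u = (x1 - x0, y1 - y0), v = (x2 - x0, y2 - y0), so the three
   points would be ordered on a line, and the middle one would not be exposed. *)
Lemma exposed_not_collinear (x0 y0 x1 y1 x2 y2 p0 q0 p1 q1 p2 q2 : R) :
  p0 * x1 + q0 * y1 < p0 * x0 + q0 * y0 ->
  p0 * x2 + q0 * y2 < p0 * x0 + q0 * y0 ->
  p1 * x0 + q1 * y0 < p1 * x1 + q1 * y1 ->
  p1 * x2 + q1 * y2 < p1 * x1 + q1 * y1 ->
  p2 * x0 + q2 * y0 < p2 * x2 + q2 * y2 ->
  p2 * x1 + q2 * y1 < p2 * x2 + q2 * y2 ->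
  (x1 - x0) * (y2 - y0) - (y1 - y0) * (x2 - x0) != 0.
Proof.
move=> h01 h02 h10 h12 h20 h21; apply/negP => /eqP.
set u := x1 - x0; set u' := y1 - y0; set v := x2 - x0; set v' := y2 - y0 => D.
have a0 : p0 * u + q0 * u' < 0 by rewrite /u /u'; lra.
have b0 : p0 * v + q0 * v' < 0 by rewrite /v /v'; lra.
have c0 : 0 < p1 * u + q1 * u' by rewrite /u /u'; lra.
have c1 : p1 * v + q1 * v' < p1 * u + q1 * u' by rewrite /u /u' /v /v'; lra.
have d0 : 0 < p2 * v + q2 * v' by rewrite /v /v'; lra.
have d1 : p2 * u + q2 * u' < p2 * v + q2 * v' by rewrite /u /u' /v /v'; lra.
(* The two sides differ by a multiple of the determinant, which [D] makes zero. *)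
have swap p q r s : (p * u + q * u') * (r * v + s * v') =
    (p * v + q * v') * (r * u + s * u').
  apply/eqP; rewrite -subr_eq0; apply/eqP.
  by transitivity ((p * s - q * r) * (u * v' - u' * v)); [ring|rewrite D mulr0].
have E1 := swap p0 q0 p1 q1; have E2 := swap p0 q0 p2 q2.
move: a0 b0 c0 c1 d0 d1 E1 E2.
set a := p0 * u + _; set b := p0 * v + _; set c := p1 * u + _; set d := p2 * v + _.
move=> a0 b0 c0 c1 d0 d1 E1 E2.
have ab : a < b.
  by rewrite -(ltr_pM2r c0) -E1 ltr_nM2l.
have ba : b < a.
  by rewrite -(ltr_pM2r d0) E2 ltr_nM2l.
by have := lt_trans ab ba; rewrite ltxx.
Qed.

Lemma free_pair (u v : 'cV[R]_2) :
  u 0 0 * v 1 0 - u 1 0 * v 0 0 != 0 -> free [:: u; v].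
Proof.
move=> D; rewrite -[[:: u; v]]/(tval [tuple u; v]); apply/freeP => c.
rewrite !big_ord_recl big_ord0 addr0 /= => h.
have h0 := congr1 (fun x : 'cV_2 => x 0 0) h.
have h1 := congr1 (fun x : 'cV_2 => x 1 0) h.
move: h0 h1; rewrite !mxE; set a := c ord0; set b := c (lift _ _) => h0 h1.
have Ea : a * (u 0 0 * v 1 0 - u 1 0 * v 0 0) = 0.
  transitivity ((a * u 0 0 + b * v 0 0) * v 1 0 - (a * u 1 0 + b * v 1 0) * v 0 0).
    by ring.
  by rewrite h0 h1 !mul0r subrr.
have Eb : b * (u 0 0 * v 1 0 - u 1 0 * v 0 0) = 0.
  transitivity ((a * u 1 0 + b * v 1 0) * u 0 0 - (a * u 0 0 + b * v 0 0) * u 1 0).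
    by ring.
  by rewrite h0 h1 !mul0r subrr.
move/eqP: Ea; move/eqP: Eb; rewrite !mulf_eq0 (negPf D) !orbF => /eqP Eb /eqP Ea.
case=> [[|[|//]] i]; first by rewrite -[RHS]Ea; congr c; apply/val_inj.
by rewrite -[RHS]Eb; congr c; apply/val_inj.
Qed.

Lemma free_pair_span (s : 2.-tuple 'cV[R]_2) x : free s -> x \in span s.
Proof.
move=> fs; suff -> : span s = fullv by rewrite memvf.
apply/eqP; rewrite eqEdim subvf/= dimvf; move: fs; rewrite /free => /eqP ->.
by rewrite size_tuple dim_matrix.
Qed.

End PlaneDuality.

Section VPolygon.
Variables (R : realType) (m : nat) (M : 'M[R]_(2, m)).

(** These strict inequalities certify [R2] when [3 <= m]. They depend continuously on [M], so the
    certificate survives small perturbations. *)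
Definition cols_exposed (p : 'I_m -> 'rV[R]_2) :=
  forall j i, i != j -> dotp (p j) (col i M) < dotp (p j) (col j M).

Lemma Ppoly_col j : Ppoly M (col j M).
Proof. by apply: sub_conv_hull; exists j. Qed.

(** Otherwise every column, hence the whole hull with [v] in it, lies in the open half-plane
    [g x < c]. *)
Lemma vertex_Ppoly_col :
  [set v | is_vertex (Ppoly M) v] `<=` range (fun j => col j M).
Proof.
move=> v [g [c [gc vE]]]; apply: contrapT => nv.
have vP : [set v] v by [].
rewrite vE in vP; case: vP => Pv gv.
suff : g v < c by rewrite gv ltxx.
have : Ppoly M `<=` [set x | g x < c].
  apply: conv_hull_sub; first exact: convex_open_halfspace.
  move=> _ [j _ <-]; rewrite /= lt_neqAle (gc _ (Ppoly_col j)) andbT; apply/eqP => gj.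
  apply: nv; exists j => //.
  by have : [set v] (col j M) by rewrite vE; split=> //; exact: Ppoly_col.
by apply.
Qed.

Lemma R2_exposed : R2 M -> exists p, cols_exposed p.
Proof.
move=> [_ cV].
have [cinj VE] := eq_range_ord cV vertex_Ppoly_col.
suff /choice[p hp] j : exists p, forall i, i != j ->
    dotp p (col i M) < dotp p (col j M) by exists p.
have [g [c [gc vE]]] : is_vertex (Ppoly M) (col j M).
  have : range (fun j => col j M) (col j M) by exists j.
  by rewrite -VE.
have [p gp] := scalar_dotp g.
exists p => i ij; rewrite -!gp.
have -> : g (col j M) = c.
  by have : [set col j M] (col j M) by []; rewrite vE => -[].
rewrite lt_neqAle (gc _ (Ppoly_col i)) andbT; apply: contraNneq ij => gi.
have : [set col j M] (col i M) by rewrite vE; split=> //; exact: Ppoly_col.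
by move=> /= /cinj ->.
Qed.

Lemma exposed_det p (i j k : 'I_m) : cols_exposed p -> i != j -> i != k -> j != k ->
  (M 0 j - M 0 i) * (M 1 k - M 1 i) - (M 1 j - M 1 i) * (M 0 k - M 0 i) != 0.
Proof.
move=> hp ij ik jk.
have E a b : b != a -> p a 0 0 * M 0 b + p a 0 1 * M 1 b < p a 0 0 * M 0 a + p a 0 1 * M 1 a.
  by move=> /hp; rewrite !dotpE !mxE.
by apply: (@exposed_not_collinear R _ _ _ _ _ _ (p i 0 0) (p i 0 1)
  (p j 0 0) (p j 0 1) (p k 0 0) (p k 0 1)); apply: E => //; rewrite eq_sym.
Qed.

Lemma exposed_R2 p : (3 <= m)%N -> cols_exposed p -> R2 M.
Proof.
move=> m3 hp.
split; first split.
- exists (range (fun j => col j M)) => //.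
  by apply: finite_image; exact: finite_finset.
- pose i0 := Ordinal (leq_trans (isT : (0 < 3)%N) m3).
  pose i1 := Ordinal (leq_trans (isT : (1 < 3)%N) m3).
  pose i2 := Ordinal (leq_trans (isT : (2 < 3)%N) m3).
  have fs : free [tuple col i1 M - col i0 M; col i2 M - col i0 M].
    by apply: free_pair; rewrite !mxE; apply: (exposed_det hp).
  exists (col i0 M), [tuple col i1 M - col i0 M; col i2 M - col i0 M].
  split=> [||i|x _]; [exact: Ppoly_col|exact: fs| |exact: free_pair_span].
  by case: i => [[|[|//]] i]; rewrite (tnth_nth 0)/= addrC subrK; exact: Ppoly_col.
suff -> : [set v | is_vertex (Ppoly M) v] = range (fun j => col j M).
  apply: card_eq_range_ord => i j cij; apply/eqP; apply: contraT => ij.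
  by have := hp _ _ ij; rewrite cij ltxx.
apply/seteqP; split=> [|_ [j _ <-]]; first exact: vertex_Ppoly_col.
(* A point together with an open half-plane bounded by a line through it is convex, so the hull
   meets that line in column [j] only. *)
pose A := [set x | x = col j M \/ dotp (p j) x < dotp (p j) (col j M)].
have PA : Ppoly M `<=` A.
  apply: conv_hull_sub; last first.
    move=> _ [i _ <-]; rewrite /A/=.
    by have [->|/hp] := eqVneq i j; [left|right].
  apply/convex_setP => x y t Ax Ay t0 t1.
  have [->|tN0] := eqVneq t 0; first by rewrite scale0r add0r subr0 scale1r.
  have [->|tN1] := eqVneq t 1; first by rewrite subrr scale0r addr0 scale1r.
  have {}t0 : 0 < t by rewrite lt_neqAle eq_sym tN0.
  have {}t1 : 0 < 1 - t by rewrite subr_gt0 lt_neqAle tN1.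
  have lin : dotp (p j) (t *: x + (1 - t) *: y) =
      t * dotp (p j) x + (1 - t) * dotp (p j) y.
    by rewrite linearD !linearZ.
  case: Ax Ay => [->|hx] [hy|hy].
  - by left; rewrite hy -scalerDl addrC subrK scale1r.
  - by right; rewrite linearD !linearZ/=; nra.
  - by right; rewrite lin hy; nra.
  - by right; rewrite lin; nra.
exists (dotp (p j)), (dotp (p j) (col j M)); split.
  by move=> x /PA[->//|/ltW].
apply/seteqP; split=> [_ ->|x [Px E]]; first by split=> //; exact: Ppoly_col.
by case: (PA _ Px) => // h; move: h; rewrite E ltxx.
Qed.

End VPolygon.

(** * Polygons given by inequalities *)

Section PolytopeBounded.
Variables (R : realType) (V : vectType R).

Lemma polytope_bounded (K : set V) (g : {scalar V}) : is_polytope K ->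
  exists C, forall x, K x -> g x <= C.
Proof.
move=> [S /finite_seqP[s ->] ->]; exists (\sum_(y <- s) `|g y|).
apply: conv_hull_sub; first exact: convex_halfspace.
move=> x /= xs; rewrite (le_trans (ler_norm _))//.
by rewrite (big_rem x)//= lerDl sumr_ge0.
Qed.

End PolytopeBounded.

Section HPolygon.
Variables (R : realType) (n : nat) (M' : 'M[R]_(n, 2)).

Definition rowform (i : 'I_n) : {scalar 'cV[R]_2} := dotp (row i M').

Lemma QpolyE : Qpoly M' = hpoly rowform.
Proof.
have E i x : rowform i x = (M' *m x) i 0 by rewrite /rowform/= /dotp -row_mul mxE.
by apply/seteqP; split=> x h i; [rewrite E|rewrite -E]; exact: h.
Qed.

Definition rows_no_recession :=
  forall d : 'cV[R]_2, (forall i, rowform i d <= 0) -> d = 0.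

(** The point [p i] certifies that constraint [i] contributes a side of its own; the notion is polar
    to [cols_exposed]. *)
Definition rows_exposed (p : 'I_n -> 'cV[R]_2) :=
  forall i, rowform i (p i) = 1 /\ forall k, k != i -> rowform k (p i) < 1.

Definition side i : set 'cV[R]_2 := [set x | hpoly rowform x /\ rowform i x = 1].

Lemma side_face i : is_face (hpoly rowform) (side i).
Proof. by exists (rowform i), 1; split. Qed.

Lemma hpoly0 : hpoly rowform 0.
Proof. by move=> i; rewrite linear0 ler01. Qed.

Lemma rowform1_neq0 i x : rowform i x = 1 -> row i M' != 0.
Proof.
apply: contra_eq_neq => ri0.
by rewrite /rowform/= ri0 /dotp mul0mx mxE eq_sym oner_eq0.
Qed.

Lemma dotp_tr (p : 'rV[R]_2) (x : 'cV[R]_2) : dotp x^T p^T = dotp p x.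
Proof. by rewrite !dotpE !mxE; ring. Qed.

Lemma form_parallel (p q : 'rV[R]_2) (s : 'cV[R]_2) : s != 0 -> dotp p s = 0 ->
  dotp q s = 0 -> p != 0 -> exists c, q = c *: p.
Proof.
move=> s0; rewrite !dotpE => ps qs p0.
have D : q 0 0 * p 0 1 = q 0 1 * p 0 0.
  have [s00|s00] := eqVneq (s 0 0) 0.
    have s10 : s 1 0 != 0.
      by apply: contraNneq s0 => s10; apply/eqP/cV2P; rewrite mxE.
    move: ps qs; rewrite s00 !mulr0 !add0r => /eqP.
    rewrite mulf_eq0 (negPf s10) orbF => /eqP-> /eqP.
    by rewrite mulf_eq0 (negPf s10) orbF => /eqP->; rewrite mulr0 mul0r.
  apply: (mulIf s00).
  have -> : q 0 0 * p 0 1 * s 0 0 = p 0 1 * (q 0 0 * s 0 0) by ring.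
  have -> : q 0 1 * p 0 0 * s 0 0 = q 0 1 * (p 0 0 * s 0 0) by ring.
  have -> : p 0 0 * s 0 0 = - (p 0 1 * s 1 0) by lra.
  have -> : q 0 0 * s 0 0 = - (q 0 1 * s 1 0) by lra.
  ring.
have [p00|p00] := eqVneq (p 0 0) 0.
  have p01 : p 0 1 != 0.
    by apply: contraNneq p0 => p01; apply/eqP/rV2P; rewrite mxE.
  exists (q 0 1 / p 0 1); apply: rV2P; rewrite !mxE ?divfK// p00 mulr0.
  by move: D; rewrite p00 mulr0 => /eqP; rewrite mulf_eq0 (negPf p01) orbF => /eqP.
exists (q 0 0 / p 0 0); apply: rV2P; rewrite !mxE ?divfK//.
by rewrite mulrAC D mulfK.
Qed.

Lemma has_dim1P (F : set 'cV[R]_2) : has_dim F 1 ->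
  exists x s, [/\ s != 0, F x & F (x + s)].
Proof.
move=> [x [s [Fx fs Fs _]]]; exists x, (tnth s 0); split=> //.
by apply: (free_not0 fs); exact: mem_tnth.
Qed.

(** Some constraint is tight at the midpoint of two points of the edge, since [g] is not zero. It is
    then tight at both points, hence proportional to [g]. *)
Lemma edge_side F : has_dim (hpoly rowform) 2 -> is_edge (hpoly rowform) F ->
  exists i, F = side i.
Proof.
move=> Q2 [[g [c [gc FE]]] F1].
have [x [s [s0 Fx Fxs]]] := has_dim1P F1.
have [q gq] := scalar_dotp g.
move: Fx Fxs; rewrite FE => -[Qx gx] [Qxs gxs].
have gs : g s = 0.
  by move: gxs; rewrite linearD gx/= => /eqP; rewrite -subr_eq0 addrC addKr => /eqP.
have gN0 : exists y, g y != 0.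
  apply: contrapT => /forallNP g0.
  have {}g0 y : g y = 0 by apply/eqP; apply/negPn/negP.
  suff FQ : F = hpoly rowform by move: F1; rewrite FQ => /(has_dim_uniq Q2).
  by rewrite FE; apply/seteqP; split=> [z []//|z Qz]; split=> //; rewrite g0 -gx g0.
pose h := x + 2^-1 *: s.
have lh i : rowform i h = 2^-1 * (rowform i x + rowform i (x + s)).
  by rewrite /h !linearD !linearZ/=; field.
have Qh : hpoly rowform h.
  by move=> i; rewrite lh; have := Qx i; have := Qxs i; lra.
have gh : g h = c by rewrite /h linearD linearZ/= gs mulr0 addr0.
have [i ih] : exists i, rowform i h = 1.
  apply: contrapT => /forallNP hN; case: gN0 => y /eqP; apply.
  have st z : g z <= 0.
    have [t t0 Qt] : exists2 t, 0 < t & hpoly rowform (h + t *: z).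
      by apply: hpoly_step => // i /hN.
    by have := gc _ Qt; rewrite linearD linearZ/= gh gerDl pmulr_rle0.
  apply/eqP; rewrite eq_le st/= -oppr_le0.
  by have := st (- y); rewrite linearN.
have [ix ixs] : rowform i x = 1 /\ rowform i (x + s) = 1.
  by move: ih; rewrite lh; have := Qx i; have := Qxs i; split; lra.
have is0 : rowform i s = 0.
  by move: ixs; rewrite linearD ix/= => /eqP; rewrite -subr_eq0 addrC addKr => /eqP.
have iN0 := rowform1_neq0 ix.
have [r qE] : exists r, q = r *: row i M'.
  by apply: form_parallel s0 _ _ iN0; [exact: is0|rewrite -gq].
have gE z : g z = r * rowform i z by rewrite gq qE /dotp -scalemxAl mxE.
have cr : c = r by rewrite -gx gE ix mulr1.
have rN0 : r != 0 by case: gN0 => y; apply: contraNneq => r0; rewrite gE r0 mul0r.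
exists i; apply/seteqP; split=> [z [Qz gz]|z [Qz iz]]; split=> //.
  by apply: (mulfI rN0); rewrite -gE gz cr mulr1.
by rewrite gE iz mulr1.
Qed.

(** The midpoint of two points of side [i] serves as [p i]: a second constraint tight there would
    coincide with constraint [i], although the sides are distinct. *)
Lemma R2'_exposed : R2' M' -> exists p, rows_exposed p.
Proof.
rewrite /R2' /= QpolyE => -[[_ Q2] cE].
have [sinj EE] := eq_range_ord cE (fun F hF =>
  let: ex_intro i Fi := edge_side Q2 hF in
  ex_intro2 _ _ i I (esym Fi) : range side F).
suff /choice[p hp] i : exists p, rowform i p = 1 /\
    forall k, k != i -> rowform k p < 1 by exists p.
have [_ E1] : is_edge (hpoly rowform) (side i).
  have : range side (side i) by exists i.
  by rewrite -EE.
have [x [s [s0 [Qx ix] [Qxs ixs]]]] := has_dim1P E1.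
have lh k : rowform k (x + 2^-1 *: s) = 2^-1 * (rowform k x + rowform k (x + s)).
  by rewrite !linearD !linearZ/=; field.
exists (x + 2^-1 *: s); split; first by rewrite lh ix ixs; lra.
move=> k ki; rewrite lh.
have := Qx k; have := Qxs k; rewrite [_ <= _]le_eqVlt => /predU1P[kxs|]; last by lra.
rewrite [_ <= _]le_eqVlt => /predU1P[kx|]; last by lra.
case/eqP: ki; apply: sinj.
have dir j : rowform j x = 1 -> rowform j (x + s) = 1 -> rowform j s = 0.
  by move=> h; rewrite linearD h/= => /eqP; rewrite -subr_eq0 addrC addKr => /eqP.
have iN0 := rowform1_neq0 ix.
have [r kE] : exists r, row k M' = r *: row i M'.
  by apply: form_parallel s0 _ _ iN0; apply: dir.
have gE z : rowform k z = r * rowform i z.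
  by rewrite /rowform/= kE /dotp -scalemxAl mxE.
have r1 : r = 1 by rewrite -kx gE ix mulr1.
by apply/seteqP; split=> z [Qz hz]; split=> //; move: hz; rewrite gE r1 mul1r.
Qed.

Lemma exposed_R2' p : rows_no_recession -> rows_exposed p -> R2' M'.
Proof.
move=> nr hp.
have Q2 : has_dim (hpoly rowform) 2.
  have step z : exists t, 0 < t /\ hpoly rowform (t *: z).
    have [i|t t0 Qt] := @hpoly_step _ _ _ rowform 0 z hpoly0.
      by rewrite linear0 => /eqP; rewrite eq_sym oner_eq0.
    by exists t; rewrite add0r in Qt.
  have [t [t0 Qt]] := step (delta_mx 0 0).
  have [u [u0 Qu]] := step (delta_mx 1 0).
  have fs : free [tuple t *: delta_mx 0 0 : 'cV[R]_2; u *: delta_mx 1 0].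
    apply: free_pair; rewrite !mxE/= !(mulr1, mulr0, mul0r, subr0).
    by rewrite mulf_neq0 ?gt_eqF.
  exists 0, [tuple t *: delta_mx 0 0; u *: delta_mx 1 0].
  split=> [||i|x _]; [exact: hpoly0|exact: fs| |exact: free_pair_span].
  by case: i => [[|[|//]] i]; rewrite (tnth_nth 0)/= add0r.
rewrite /R2' /= QpolyE; split; first by split=> //; exact: hpoly_polytope.
have Qp i : hpoly rowform (p i).
  move=> k; have [->|/(proj2 (hp i) k)/ltW//] := eqVneq k i.
  by rewrite (proj1 (hp i)).
suff -> : [set F | is_edge (hpoly rowform) F] = range side.
  apply: card_eq_range_ord => i j sij; apply/eqP; apply: contraT => ij.
  have : side i (p i) by split=> //; exact: (proj1 (hp i)).
  rewrite sij => -[_ jp]; have := proj2 (hp i) j; rewrite eq_sym ij jp ltxx.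
  by move=> /(_ isT).
apply/seteqP; split=> [F /(edge_side Q2)[i ->]|_ [i _ <-]]; first by exists i.
split; first exact: side_face.
(* Row [i] turned by a right angle, the direction of its side. *)
pose s : 'cV[R]_2 := \col_k (if k == 0 then - M' i 1 else M' i 0).
have is0 : rowform i s = 0 by rewrite /rowform/= dotpE !mxE/=; ring.
have iN0 := rowform1_neq0 (proj1 (hp i)).
have s0 : s != 0.
  apply: contraNneq iN0 => s0; apply/eqP/rV2P.
    by have := congr1 (fun x : 'cV_2 => x 1 0) s0; rewrite !mxE.
  have := congr1 (fun x : 'cV_2 => x 0 0) s0; rewrite !mxE/= => /eqP.
  by rewrite oppr_eq0 => /eqP.
have [k kp|t t0 Qt] := @hpoly_step _ _ _ rowform (p i) s (Qp i).
  have [->|/(proj2 (hp i) k)] := eqVneq k i; first by rewrite is0.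
  by rewrite kp ltxx.
exists (p i), [tuple t *: s]; split.
- by split=> //; exact: (proj1 (hp i)).
- by rewrite /= seq1_free scaler_eq0 negb_or gt_eqF.
- move=> a; rewrite (tnth_nth 0) ord1/=; split=> //.
  by rewrite linearD linearZ/= is0 mulr0 addr0; exact: (proj1 (hp i)).
- move=> x [_ ix]; rewrite span_seq1.
  have xs0 : rowform i (x - p i) = 0 by rewrite linearB/= ix (proj1 (hp i)) subrr.
  suff [c ->] : exists c, x - p i = c *: s.
    by apply/vlineP; exists (c / t); rewrite scalerA divfK// gt_eqF.
  have [||||c cE] := @form_parallel s^T (x - p i)^T (row i M')^T.
  + by rewrite trmx_eq0.
  + by rewrite dotp_tr.
  + by rewrite dotp_tr.
  + by rewrite trmx_eq0.
  by exists c; apply: trmx_inj; rewrite cE linearZ.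
Qed.

End HPolygon.

(** * Zero sets of polynomial functions *)

Lemma open_dense_bigcap (X : topologicalType) (I : finType) (A : I -> set X) :
  (forall i, open (A i) /\ dense (A i)) ->
  open [set z | forall i, A i z] /\ dense [set z | forall i, A i z].
Proof.
move=> hA.
suff [oS dS] : open [set z | forall i, i \in enum I -> A i z] /\
    dense [set z | forall i, i \in enum I -> A i z].
  have -> : [set z | forall i, A i z] = [set z | forall i, i \in enum I -> A i z].
    by apply/seteqP; split=> z h i; [move=> _|]; apply: h => //; rewrite mem_enum.
  by split.
elim: (enum I) => [|i s [oS dS]].
  have -> : [set z : X | forall i, i \in [::] -> A i z] = setT by apply/seteqP; split.
  by split; [exact: openT|move=> O O0 _; rewrite setIT].
have -> : [set z | forall j, j \in i :: s -> A j z] =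
    A i `&` [set z | forall j, j \in s -> A j z].
  apply/seteqP; split=> [z h|z [Ai As] j]; last by rewrite inE => /predU1P[->//|/As].
  by split=> [|j js]; apply: h; rewrite inE ?eqxx// js orbT.
have [oA dA] := hA i.
by split; [exact: openI|exact: denseI].
Qed.

Section PolynomialFunctions.
Variables (R : realType) (V : normedModType R).
Implicit Types h g : V -> R.

(** Continuity makes the nonvanishing set open, and polynomial restrictions to lines make it dense
    unless it is empty. *)
Definition polyfun h := continuous h /\
  forall z d, exists P : {poly R}, forall t, h (z + t *: d) = P.[t].

Lemma polyfun_cst c : polyfun (fun=> c).
Proof. by split=> [z|z d]; [exact: cvg_cst|exists c%:P => t; rewrite hornerC]. Qed.

Lemma polyfunD h g : polyfun h -> polyfun g -> polyfun (fun z => h z + g z).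
Proof.
move=> [ch lh] [cg lg]; split=> [z|z d].
  by apply: cvgD; [exact: ch|exact: cg].
have [P hP] := lh z d; have [Q hQ] := lg z d.
by exists (P + Q) => t; rewrite hornerD hP hQ.
Qed.

Lemma polyfunM h g : polyfun h -> polyfun g -> polyfun (fun z => h z * g z).
Proof.
move=> [ch lh] [cg lg]; split=> [z|z d].
  by apply: cvgM; [exact: ch|exact: cg].
have [P hP] := lh z d; have [Q hQ] := lg z d.
by exists (P * Q) => t; rewrite hornerM hP hQ.
Qed.

Lemma polyfun_sum (I : Type) (r : seq I) (P : pred I) (F : I -> V -> R) :
  (forall i, polyfun (F i)) -> polyfun (fun z => \sum_(i <- r | P i) F i z).
Proof.
move=> hF; elim: r => [|i r IH].
  by under eq_fun do rewrite big_nil; exact: polyfun_cst.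
under eq_fun do rewrite big_cons.
by case: (P i) => //; exact: polyfunD.
Qed.

Lemma polyfun_prod (I : Type) (r : seq I) (P : pred I) (F : I -> V -> R) :
  (forall i, polyfun (F i)) -> polyfun (fun z => \prod_(i <- r | P i) F i z).
Proof.
move=> hF; elim: r => [|i r IH].
  by under eq_fun do rewrite big_nil; exact: polyfun_cst.
under eq_fun do rewrite big_cons.
by case: (P i) => //; exact: polyfunM.
Qed.

Lemma polyfun_det k (F : V -> 'M[R]_k) :
  (forall i j, polyfun (fun z => F z i j)) -> polyfun (fun z => \det (F z)).
Proof.
move=> hF; rewrite /determinant; apply: polyfun_sum => s.
apply: polyfunM; first exact: polyfun_cst.
by apply: polyfun_prod => i.
Qed.

Lemma polyfun_neq0_open h : polyfun h -> open [set z | h z != 0].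
Proof.
move=> [ch _]; have -> : [set z | h z != 0] = h @^-1` [set r | r != 0] by [].
by apply: open_comp; [move=> z _; exact: ch|exact: open_neq].
Qed.

(** On the line from [z] to [z1] the function is a nonzero polynomial of the parameter, so its
    finitely many roots can be avoided arbitrarily close to [z]. *)
Lemma polyfun_neq0_dense h z1 : polyfun h -> h z1 != 0 -> dense [set z | h z != 0].
Proof.
move=> [_ lh] hz1 O [z Oz] oO.
have [P hP] := lh z (z1 - z).
have P0 : P != 0.
  apply: contraNneq hz1 => P0.
  by have := hP 1; rewrite scale1r addrC subrK P0 horner0 => ->.
have cl : continuous (fun t : R => z + t *: (z1 - z)).
  by move=> t; apply: cvgD; [exact: cvg_cst|apply: cvgZr_tmp; exact: cvg_id].
have : nbhs (0 : R) [set t | O (z + t *: (z1 - z))].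
  by apply: cl; rewrite scale0r addr0; exact: open_nbhs_nbhs.
move=> /nbhs_ballP[e /= e0 he].
(* The shift to [k.+2] keeps the parameter strictly below [e] for [k = 0] too. *)
have hk k : O (z + (e / k.+2%:R) *: (z1 - z)).
  apply: he; rewrite /ball/= sub0r normrN gtr0_norm ?divr_gt0//.
  by rewrite ltr_pdivrMr// ltr_pMr// ltr1n.
have [k Pk] : exists k : nat, ~~ root P (e / k.+2%:R).
  apply: contrapT => /forallNP h0.
  pose rs := [seq e / k.+2%:R | k <- iota 0 (size P)].
  have : (size rs < size P)%N.
    apply: max_poly_roots => //.
      by apply/allP => _ /mapP[k _ ->]; apply/negPn/negP; exact: h0.
    rewrite map_inj_uniq ?iota_uniq// => a b.
    move=> /(mulfI (lt0r_neq0 e0))/invr_inj/eqP.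
    by rewrite eqr_nat => /eqP[].
  by rewrite size_map size_iota ltnn.
exists (z + (e / k.+2%:R) *: (z1 - z)); split; first exact: hk.
by rewrite /= hP.
Qed.

End PolynomialFunctions.

(** If [v] annihilates the Gram matrix, then [v *m W] has squared length zero, hence vanishes over
    the reals. *)
Lemma row_free_gram (R : realType) k q (W : 'M[R]_(k, q)) :
  row_free W = (\det (W *m W^T) != 0).
Proof.
rewrite -unitfE -unitmxE -row_free_unit.
apply/idP/idP => [Wf|]; last first.
  by rewrite -!row_leq_rank => /leq_trans; apply; exact: mxrankM_maxl.
apply: inj_row_free => v vW.
have {vW} vW : (v *m W) *m (v *m W)^T = 0.
  by rewrite trmx_mul mulmxA -[v *m W *m _]mulmxA vW mul0mx.
have : v *m W = 0.
  apply/rowP => i; rewrite [RHS]mxE; apply/eqP; rewrite -sqrf_eq0; apply/eqP.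
  have /eqP := congr1 (fun A : 'M[R]_1 => A 0 0) vW.
  rewrite mxE [X in _ == X]mxE psumr_eq0; last first.
    by move=> j _; rewrite [_^T _ _]mxE -expr2 sqr_ge0.
  move=> /allP/(_ i (mem_index_enum _))/=.
  by rewrite [_^T _ _]mxE -expr2 => /eqP.
by move=> vW0; apply: (row_free_injr Wf); rewrite /= vW0 mul0mx.
Qed.

(** * Openness and genericity *)

Section Openness.
Variable R : realType.

Lemma near_gt0 (X : topologicalType) (h : X -> R) x : {for x, continuous h} ->
  0 < h x -> \forall y \near x, 0 < h y.
Proof. by move=> ch hx; exact: (cvgr_gt _ ch). Qed.

Lemma polyfun_coord a b (i : 'I_a) (j : 'I_b) :
  polyfun (fun M : 'M[R]_(a, b) => M i j).
Proof.
split; first exact: coord_continuous.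
move=> z d; exists ((z i j)%:P + (d i j)%:P * 'X) => t.
by rewrite !mxE !hornerE mulrC.
Qed.

Lemma R2_open m : (3 <= m)%N -> open (@R2 R m).
Proof.
move=> m3; rewrite openE => M0 /R2_exposed[p hp].
suff : \forall M \near M0, forall ji : 'I_m * 'I_m, ji.2 != ji.1 ->
    0 < dotp (p ji.1) (col ji.1 M) - dotp (p ji.1) (col ji.2 M).
  apply: filterS => M hM; apply: (@exposed_R2 _ _ _ p) => // j i ij.
  by rewrite -subr_gt0; exact: (hM (j, i)).
apply: (@filter_forall _ _ _ (nbhs M0)) => -[j i] /=.
have [->|ij] := eqVneq i j; first by apply: nearW.
have : \forall M \near M0, 0 < dotp (p j) (col j M) - dotp (p j) (col i M).
  apply: near_gt0; last by rewrite subr_gt0; exact: hp.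
  suff [c _] : polyfun (fun M : 'M[R]_(2, m) =>
      dotp (p j) (col j M) - dotp (p j) (col i M)) by exact: c.
  under eq_fun do rewrite !dotpE !mxE -mulN1r.
  by do ?[exact: polyfun_cst|exact: polyfun_coord|apply: polyfunD|apply: polyfunM].
by apply: filterS.
Qed.

(** The witnesses [p i] survive up to rescaling. As for boundedness, a recession direction of a
    nearby matrix, stretched beyond a box around the polygon of [M0], would still satisfy the
    constraints of [M0]. *)
Lemma R2'_open n : open (@R2' R n).
Proof.
rewrite openE => M0 hM0; have [p hp] := R2'_exposed hM0.
have cf k i : polyfun (fun M : 'M[R]_(n, 2) => rowform M k (p i)).
  under eq_fun do rewrite /rowform/= dotpE !mxE.
  by do ?[exact: polyfun_cst|exact: polyfun_coord|apply: polyfunD|apply: polyfunM].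
have [C C1 hC] : exists2 C, 1 <= C & forall x, hpoly (rowform M0) x ->
    `|x 0 0| <= C /\ `|x 1 0| <= C.
  move: hM0; rewrite /R2' /= QpolyE => -[[Kp _] _].
  have [C1 h1] := polytope_bounded (dotp (delta_mx 0 0)) Kp.
  have [C2 h2] := polytope_bounded (dotp (- delta_mx 0 0)) Kp.
  have [C3 h3] := polytope_bounded (dotp (delta_mx 0 1)) Kp.
  have [C4 h4] := polytope_bounded (dotp (- delta_mx 0 1)) Kp.
  have [l1 l2 l3 l4] := And4 (ler_norm C1) (ler_norm C2) (ler_norm C3) (ler_norm C4).
  have [n1 n2 n3 n4] := And4 (normr_ge0 C1) (normr_ge0 C2) (normr_ge0 C3) (normr_ge0 C4).
  exists (1 + `|C1| + `|C2| + `|C3| + `|C4|); first by lra.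
  move=> x Kx.
  move: (h1 x Kx) (h2 x Kx) (h3 x Kx) (h4 x Kx).
  rewrite /= !dotpE !mxE/= !ler_norml.
  by move=> ? ? ? ?; split; apply/andP; split; lra.
have near1 : \forall M \near M0, forall ik : 'I_n * 'I_n,
    0 < rowform M ik.1 (p ik.1) /\
    (ik.2 != ik.1 -> 0 < rowform M ik.1 (p ik.1) - rowform M ik.2 (p ik.1)).
  apply: (@filter_forall _ _ _ (nbhs M0)) => -[i k] /=.
  have n1 : \forall M \near M0, 0 < rowform M i (p i).
    apply: (near_gt0 (h := fun M => rowform M i (p i))); first exact: (cf i i).1.
    by rewrite (proj1 (hp i)).
  have [->|ki] := eqVneq k i; first by apply: filterS n1.
  have n2 : \forall M \near M0, 0 < rowform M i (p i) - rowform M k (p i).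
    apply: (near_gt0 (h := fun M => rowform M i (p i) - rowform M k (p i))).
      suff [c _] : polyfun (fun M => rowform M i (p i) - rowform M k (p i)) by exact: c.
      under eq_fun do rewrite -mulN1r.
      by apply: polyfunD => //; apply: polyfunM => //; exact: polyfun_cst.
    by rewrite (proj1 (hp i)) subr_gt0; exact: (proj2 (hp i)).
  by apply: filterS2 n1 n2.
have C0 : 0 < C by lra.
(* Two entries, each off by at most [(4 * C)^-1] and multiplied by at most [2 * C], change a row
   form by at most 1. *)
have near2 : nbhs M0 (fun M : 'M[R]_(n, 2) => forall ik : 'I_n * 'I_2,
    `|M0 ik.1 ik.2 - M ik.1 ik.2| <= (4 * C)^-1).
  apply: (@filter_forall _ _ _ (nbhs M0)) => -[i k] /=.
  apply: (@cvgr_dist_le _ _ _ (nbhs M0) _ (fun M : 'M[R]_(n, 2) => M i k) (M0 i k)).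
    exact: coord_continuous.
  by rewrite invr_gt0; lra.
apply: filterS2 near1 near2 => M h1 h2.
apply: (@exposed_R2' _ _ _ (fun i => (rowform M i (p i))^-1 *: p i)).
  move=> d hd; apply: contrapT => /eqP d0.
  pose N := Num.max `|d 0 0| `|d 1 0|.
  have N0 : 0 < N.
    rewrite /N lt_max !normr_gt0 -negb_and; apply: contraNN d0 => /andP[/eqP? /eqP?].
    by apply/eqP/cV2P; rewrite mxE.
  have [r r0 rN] : exists2 r, 0 < r & r * N = 2 * C.
    by exists (2 * C / N); rewrite ?divfK ?gt_eqF// divr_gt0// mulr_gt0.
  have b0 : `|r * d 0 0| <= 2 * C.
    by rewrite normrM gtr0_norm// -rN ler_pM2l// le_max lexx.
  have b1 : `|r * d 1 0| <= 2 * C.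
    by rewrite normrM gtr0_norm// -rN ler_pM2l// le_max lexx orbT.
  have [|c0 c1] := hC (r *: d).
    move=> i; have hdi : rowform M i (r *: d) <= 0.
      by rewrite linearZ/= pmulr_rle0//; exact: hd.
    suff : rowform M0 i (r *: d) - rowform M i (r *: d) <= 1 by lra.
    rewrite /rowform/= !dotpE !mxE.
    have -> : M0 i 0 * (r * d 0 0) + M0 i 1 * (r * d 1 0) -
        (M i 0 * (r * d 0 0) + M i 1 * (r * d 1 0)) =
        (M0 i 0 - M i 0) * (r * d 0 0) + (M0 i 1 - M i 1) * (r * d 1 0) by ring.
    have B k x : `|x| <= 2 * C -> (M0 i k - M i k) * x <= 2^-1.
      move=> hx; rewrite (le_trans (ler_norm _))// normrM.
      have -> : 2^-1 = (4 * C)^-1 * (2 * C) by field; rewrite gt_eqF.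
      by apply: ler_pM => //; exact: (h2 (i, k)).
    by have := B 0 _ b0; have := B 1 _ b1; lra.
  move: c0 c1; rewrite !mxE !normrM !(gtr0_norm r0) => c0 c1.
  have : r * N <= C.
    by rewrite /N; case: (leP `|d 0 0| `|d 1 0|).
  by rewrite rN; lra.
move=> i; have [ci _] := h1 (i, i); rewrite /= in ci.
split=> [|k ki]; first by rewrite linearZ/= mulVf// gt_eqF.
have [_ /(_ ki)] := h1 (i, k); rewrite /= subr_gt0 => hk.
by rewrite linearZ/= mulrC ltr_pdivrMr// mul1r.
Qed.

End Openness.

Section Generic.
Variables (R : realType) (m n : nat).
Local Notation Z := ('M[R]_(2, m) * 'M[R]_(n, 2))%type.
Local Notation E := ('I_n * 'I_m)%type.

(* The coefficients of the affine function f |-> a_i (A x_j + b) - 1 of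
   f = (A, b), where x_j = col j z.1 and a_i = row i z.2. *)
Definition incidence (z : Z) (e : E) : 'rV[R]_((2 + 2) + (2 + 1)) :=
  row_mx (row_mx (z.1 0 e.2 *: row e.1 z.2) (z.1 1 e.2 *: row e.1 z.2))
         (row_mx (row e.1 z.2) (-1)).

Definition incidence_mx (z : Z) (T : {set E}) : 'M[R]_(#|T|, (2 + 2) + (2 + 1)) :=
  \matrix_(k < #|T|) incidence z (enum_val k).

Lemma incidence_mxE z T k q :
  incidence_mx z T k q = incidence z (enum_val k) 0 q.
Proof. by rewrite mxE. Qed.

Definition indep z T := row_free (incidence_mx z T).

Definition generic : set Z :=
  [set z | forall T, (exists z1, indep z1 T) -> indep z T].

Lemma indepP z T : indep z T <-> forall c : E -> R,
  \sum_(e in T) c e *: incidence z e = 0 -> forall e, e \in T -> c e = 0.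
Proof.
split=> [iT c cs e eT|h].
  have : (\row_k c (enum_val k)) *m incidence_mx z T = 0.
    rewrite mulmx_sum_row -[RHS]cs [RHS]big_enum_val/=.
    by apply: eq_bigr => k _; rewrite !mxE rowK.
  move=> u0; have {u0} : (\row_(k < #|T|) c (enum_val k)) = 0.
    by apply: (row_free_injr iT); rewrite /= u0 mul0mx.
  move=> /(congr1 (fun u : 'rV[R]_#|T| => u 0 (enum_rank_in eT e))).
  by rewrite !mxE enum_rankK_in.
apply: inj_row_free => u.
have [k0|/card_gt0P[e0 e0T]] := posnP #|T|.
  by move=> _; apply/rowP => k; have := ltn_ord k; rewrite {2}k0.
pose c e := u 0 (enum_rank_in e0T e).
rewrite mulmx_sum_row => us; apply/rowP => k; rewrite mxE.
have -> : u 0 k = c (enum_val k) by rewrite /c enum_valK_in.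
apply: h; last exact: enum_valP.
rewrite big_enum_val/= -[RHS]us; apply: eq_bigr => k' _.
by rewrite rowK /c enum_valK_in.
Qed.

Lemma polyfun_incidence e q : polyfun (fun z : Z => incidence z e 0 q).
Proof.
have p1 i j : polyfun (fun z : Z => z.1 i j).
  have [c l] := @polyfun_coord R 2 m i j; split.
    move=> z; apply: (@cvg_comp _ _ _ (@fst _ _) (fun M : 'M[R]_(2, m) => M i j)).
      exact: cvg_fst.
    exact: c.
  by move=> z d; exact: (l z.1 d.1).
have p2 i j : polyfun (fun z : Z => z.2 i j).
  have [c l] := @polyfun_coord R n 2 i j; split.
    move=> z; apply: (@cvg_comp _ _ _ (@snd _ _) (fun M : 'M[R]_(n, 2) => M i j)).
      exact: cvg_snd.
    exact: c.
  by move=> z d; exact: (l z.2 d.2).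
rewrite /incidence.
under eq_fun do rewrite mxE.
case: (fintype.split q) => q1; under eq_fun do rewrite mxE; case: (fintype.split q1) => q2;
  under eq_fun do rewrite ?mxE.
- by apply: polyfunM.
- by apply: polyfunM.
- exact: p2.
- exact: polyfun_cst.
Qed.

(** For each of the finitely many [T], either no pair gives independence and the condition is void,
    or the Gram determinant is a polynomial function with a nonzero value. *)
Lemma generic_open_dense : open generic /\ dense generic.
Proof.
apply: (@open_dense_bigcap Z _
  (fun T => [set z | (exists z1, indep z1 T) -> indep z T])) => T.
have [[z1 iz1]|nz] := pselect (exists z1, indep z1 T); last first.
  have -> : [set z | (exists z1, indep z1 T) -> indep z T] = setT.
    by apply/seteqP; split=> // z _ /nz.
  by split; [exact: openT|move=> O O0 _; rewrite setIT].
have -> : [set z | (exists z1, indep z1 T) -> indep z T] =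
    [set z | \det (incidence_mx z T *m (incidence_mx z T)^T) != 0].
  by apply/seteqP; split=> z; rewrite /= -row_free_gram// => h; apply: h; exists z1.
have pf : polyfun (fun z => \det (incidence_mx z T *m (incidence_mx z T)^T)).
  apply: polyfun_det => i j; under eq_fun do rewrite mxE.
  apply: polyfun_sum => q; under eq_fun do rewrite [_^T _ _]mxE !incidence_mxE.
  by apply: polyfunM; exact: polyfun_incidence.
split; first exact: polyfun_neq0_open.
by apply: (polyfun_neq0_dense pf (z1 := z1)); rewrite -row_free_gram.
Qed.

End Generic.

(** * Incidences and tight constraints *)

Section Incidence.
Variables (R : realType) (m n : nat).
Local Notation Z := ('M[R]_(2, m) * 'M[R]_(n, 2))%type.
Local Notation E := ('I_n * 'I_m)%type.
Implicit Types (z : Z) (e : E) (T : {set E}) (f : affmap R).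

Definition homform_fun z e f : R := dotp (row e.1 z.2) (affmap_fun f (col e.2 z.1)).

Lemma homform_is_scalar z e : scalar (homform_fun z e).
Proof.
move=> c f g; rewrite -[RHS]linearP; congr dotp.
rewrite /affmap_fun /= mulmxDl -scalemxAl scalerDr.
by rewrite -!addrA; congr (_ + _); rewrite addrCA.
Qed.

HB.instance Definition _ z e :=
  GRing.isLinear.Build R (affmap R) R _ (homform_fun z e) (homform_is_scalar z e).

Definition homform z e : {scalar affmap R} := homform_fun z e.

Lemma homformE z e f : homform z e f = dotp (row e.1 z.2) (affmap_fun f (col e.2 z.1)).
Proof. by []. Qed.

(** The preimage of [Qpoly M'] under an affine map is convex, so testing the columns suffices. *)
Lemma aff_homE (M : 'M[R]_(2, m)) (M' : 'M[R]_(n, 2)) :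
  aff_hom (Ppoly M) (Qpoly M') = hpoly (homform (M, M')).
Proof.
rewrite QpolyE; apply/seteqP; split=> f hf.
  by move=> [i j]; apply: hf; exists (col j M) => //; exact: Ppoly_col.
move=> _ [x Px <-]; move: x Px.
apply: conv_hull_sub; last by move=> _ [j _ <-] i; exact: (hf (i, j)).
apply/convex_setP => x y t Kx Ky t0 t1.
have -> : affmap_fun f (t *: x + (1 - t) *: y) =
    t *: affmap_fun f x + (1 - t) *: affmap_fun f y.
  rewrite /affmap_fun mulmxDr -!scalemxAr !scalerDr addrACA; congr (_ + _).
  by rewrite -scalerDl addrC subrK scale1r.
by have /convex_setP := @hpoly_convex R _ _ (rowform M'); apply.
Qed.

(** The coordinate [s] homogenizes: [s = 1] measures the failure of tightness, [s = 0] keeps the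
    linear form. *)
Lemma incidence_mul z e f s :
  (incidence z e *m col_mx (col_mx (col 0 f.1) (col 1 f.1)) (col_mx f.2 s%:M)) 0 0 =
  homform z e f - s.
Proof.
rewrite /incidence !mul_row_col mul_mx_scalar homformE /affmap_fun linearD/=.
rewrite !dotpE !mxE !big_ord_recl !big_ord0 !mxE /= ?mulr1n.
have -> : lift ord0 ord0 = 1 :> 'I_2 by apply/val_inj.
have -> : ord0 = 0 :> 'I_2 by apply/val_inj.
by ring.
Qed.

(** A vector is zero when its products with all pairs [(f, s)] vanish, as these fill the
    seven-dimensional space; the terms in [f] and in [s] vanish separately. *)
Lemma incidence_sum0 z T (c : E -> R) :
  \sum_(e in T) c e *: incidence z e = 0 <->
  (forall f, \sum_(e in T) c e * homform z e f = 0) /\ \sum_(e in T) c e = 0.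
Proof.
have mulE f s : ((\sum_(e in T) c e *: incidence z e) *m
    col_mx (col_mx (col 0 f.1) (col 1 f.1)) (col_mx f.2 s%:M)) 0 0 =
    \sum_(e in T) c e * homform z e f - s * \sum_(e in T) c e.
  rewrite mulmx_suml summxE mulr_sumr -sumrB; apply: eq_bigr => e _.
  by rewrite -scalemxAl mxE incidence_mul mulrBr [s * _]mulrC.
split=> [h|[h1 h2]].
  have {}mulE f s : \sum_(e in T) c e * homform z e f - s * \sum_(e in T) c e = 0.
    by rewrite -mulE h mul0mx mxE.
  have c0 : \sum_(e in T) c e = 0.
    have := mulE 0 1; rewrite mul1r big1 ?sub0r; last first.
      by move=> e _; rewrite linear0 mulr0.
    by move/eqP; rewrite oppr_eq0 => /eqP.
  by split=> // f; have := mulE f 0; rewrite mul0r subr0.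
apply/rowP => q; rewrite [RHS]mxE.
have -> : forall u : 'rV[R]_(2 + 2 + (2 + 1)), u 0 q = (u *m delta_mx q (0 : 'I_1)) 0 0.
  by move=> u; rewrite -colE mxE.
pose d : 'cV[R]_(2 + 2 + (2 + 1)) := delta_mx q 0.
pose f : affmap R := (row_mx (usubmx (usubmx d)) (dsubmx (usubmx d)) : 'M[R]_(2, 1 + 1),
  usubmx (dsubmx d)).
have -> : delta_mx q 0 =
    col_mx (col_mx (col 0 f.1) (col 1 f.1)) (col_mx f.2 (dsubmx (dsubmx d) 0 0)%:M).
  rewrite -[LHS]vsubmxK -[usubmx (delta_mx q 0)]vsubmxK -[dsubmx (delta_mx q 0)]vsubmxK.
  congr (col_mx (col_mx _ _) (col_mx _ _)); rewrite -/d.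
  - apply/colP => k; rewrite [RHS]mxE -(row_mxEl _ (dsubmx (usubmx d))).
    by congr (row_mx _ _ _ _); apply/val_inj.
  - apply/colP => k; rewrite [RHS]mxE -(row_mxEr (usubmx (usubmx d))).
    by congr (row_mx _ _ _ _); apply/val_inj.
  - by rewrite col_mxKd; exact: mx11_scalar.
by rewrite mulE h1 h2 mulr0 subr0.
Qed.

End Incidence.

(** * Independence of tight incidences *)

(** Lines through [q] are polar to collinear points, whereas three exposed rows are never
    collinear. *)
Lemma no_three_concurrent (R : realType) n (M' : 'M[R]_(n, 2)) p q (i j k : 'I_n) :
  rows_exposed M' p -> i != j -> i != k -> j != k ->
  rowform M' i q = 1 -> rowform M' j q = 1 -> rowform M' k q = 1 -> False.
Proof.
move=> hp ij ik jk; rewrite /rowform/= !dotpE !mxE => qi qj qk.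
have X a b : b != a -> p a 0 0 * M' b 0 + p a 1 0 * M' b 1 <
    p a 0 0 * M' a 0 + p a 1 0 * M' a 1.
  have [] := hp a; rewrite /rowform/= dotpE !mxE => pa1 /[apply].
  by rewrite dotpE !mxE; lra.
have D : (M' j 0 - M' i 0) * (M' k 1 - M' i 1) -
    (M' j 1 - M' i 1) * (M' k 0 - M' i 0) != 0.
  by apply: (@exposed_not_collinear R _ _ _ _ _ _ (p i 0 0) (p i 1 0)
    (p j 0 0) (p j 1 0) (p k 0 0) (p k 1 0)); apply: X => //; rewrite eq_sym.
(* Differences of the three equations form a homogeneous system for [q] with this nonzero
   determinant, so [q] is zero. *)
have q0 : q 0 0 * ((M' j 0 - M' i 0) * (M' k 1 - M' i 1) -
    (M' j 1 - M' i 1) * (M' k 0 - M' i 0)) = 0.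
  transitivity ((M' k 1 - M' i 1) * ((M' j 0 * q 0 0 + M' j 1 * q 1 0) -
      (M' i 0 * q 0 0 + M' i 1 * q 1 0)) -
    (M' j 1 - M' i 1) * ((M' k 0 * q 0 0 + M' k 1 * q 1 0) -
      (M' i 0 * q 0 0 + M' i 1 * q 1 0))); first by ring.
  by rewrite qi qj qk subrr !mulr0 subrr.
have q1 : q 1 0 * ((M' j 0 - M' i 0) * (M' k 1 - M' i 1) -
    (M' j 1 - M' i 1) * (M' k 0 - M' i 0)) = 0.
  transitivity ((M' j 0 - M' i 0) * ((M' k 0 * q 0 0 + M' k 1 * q 1 0) -
      (M' i 0 * q 0 0 + M' i 1 * q 1 0)) -
    (M' k 0 - M' i 0) * ((M' j 0 * q 0 0 + M' j 1 * q 1 0) -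
      (M' i 0 * q 0 0 + M' i 1 * q 1 0))); first by ring.
  by rewrite qi qj qk subrr !mulr0 subrr.
move/eqP: q0; move/eqP: q1; rewrite !mulf_eq0 (negPf D) !orbF => /eqP q1 /eqP q0.
by move/eqP: qi; rewrite q0 q1 !mulr0 addr0 eq_sym oner_eq0.
Qed.

(** As no three columns are collinear, an affine function can vanish at two of them and not at a
    third. This isolates a single column within a relation. *)
Lemma exposed_separate (R : realType) m (M : 'M[R]_(2, m)) p (J : {set 'I_m}) j0 :
  cols_exposed M p -> (#|J :\ j0| <= 2)%N ->
  exists (u : 'rV[R]_2) (c : R), dotp u (col j0 M) != c /\
    forall j, j \in J :\ j0 -> dotp u (col j M) = c.
Proof.
move=> hp Jle.
have [/cards2P[j1 [j2 [j12 JE]]]|[/cards1P[j1 JE]|]] :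
    #|J :\ j0| == 2 \/ (#|J :\ j0| == 1 \/ #|J :\ j0| == 0)%N.
  by case: #|_| Jle => [|[|[|//]]] _; [right; right|right; left|left].
- have [j10 j20] : j1 != j0 /\ j2 != j0.
    have : j1 \in J :\ j0 by rewrite JE !inE eqxx.
    have : j2 \in J :\ j0 by rewrite JE !inE eqxx orbT.
    by rewrite !in_setD1 => /andP[-> _] /andP[-> _].
  (* A normal vector of the line through columns [j1] and [j2]. *)
  pose u : 'rV[R]_2 := \row_k (if k == 0 then M 1 j1 - M 1 j2 else M 0 j2 - M 0 j1).
  have uE x : dotp u x = (M 1 j1 - M 1 j2) * x 0 0 + (M 0 j2 - M 0 j1) * x 1 0.
    by rewrite dotpE !mxE.
  exists u, (dotp u (col j1 M)); split.
    have := exposed_det hp j10 j12 (_ : j0 != j2); rewrite eq_sym => /(_ j20).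
    apply: contraNneq; rewrite !uE !mxE => h; apply/eqP; lra.
  move=> j; rewrite JE !inE => /orP[/eqP->//|/eqP->].
  by rewrite !uE !mxE; ring.
- exists (p j0), (dotp (p j0) (col j1 M)); split; last first.
    by move=> j; rewrite JE inE => /eqP->.
  have : j1 \in J :\ j0 by rewrite JE inE.
  by rewrite in_setD1 => /andP[j10 _]; rewrite gt_eqF//; exact: hp.
- rewrite cards_eq0 => /eqP J0; exists 0, 1; split.
    by rewrite /dotp mul0mx mxE eq_sym oner_eq0.
  by move=> j; rewrite J0 inE.
Qed.

Section TightIndependent.
Variables (R : realType) (m n : nat).
Variables (M : 'M[R]_(2, m)) (M' : 'M[R]_(n, 2)) (f : affmap R).
Variables (p : 'I_m -> 'rV[R]_2) (p' : 'I_n -> 'cV[R]_2).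
Hypothesis (hp : cols_exposed M p) (hp' : rows_exposed M' p').
Hypothesis z_generic : generic (M, M').
Hypothesis f_unit : f.1 \in unitmx.
Local Notation z := (M, M').
Local Notation E := ('I_n * 'I_m)%type.

Definition tight (T : {set E}) := forall e, e \in T -> homform z e f = 1.

(** The vector of [f] with last entry 1 is nonzero and orthogonal to all rows, which live in
    dimension seven. *)
Lemma tight_indep_card (T : {set E}) : tight T -> indep z T -> (#|T| <= 6)%N.
Proof.
move=> tT iT.
pose phi := col_mx (col_mx (col 0 f.1) (col 1 f.1)) (col_mx f.2 (1%:M : 'M[R]_1)).
have phi0 : phi != 0.
  apply/eqP => /eqP; rewrite !col_mx_eq0 => /and3P[_ _ /eqP].
  by move/(congr1 (fun A : 'M[R]_1 => A 0 0))/eqP; rewrite !mxE oner_eq0.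
have W0 : incidence_mx z T *m phi = 0.
  apply/row_matrixP => k; rewrite row_mul rowK row0.
  apply/matrixP => a b; rewrite !ord1 incidence_mul tT ?subrr ?mxE//.
  exact: enum_valP.
have := mulmx0_rank_max W0; rewrite (eqP iT).
have : (0 < \rank phi)%N by rewrite lt0n mxrank_eq0.
by move: (\rank phi) => r r0 h; rewrite -ltnS (leq_trans _ h)// -addn1 leq_add2l.
Qed.

(* Move the j-th column of M to the zero of f: the incidence (i, j) then fails
   at f, while every other incidence in T is unaffected. *)
Lemma minimal_dep_column (T : {set E}) e : tight T -> ~ indep z T -> e \in T ->
  indep z (T :\ e) -> exists2 e', e' \in T :\ e & e'.2 = e.2.
Proof.
move=> tT dT eT iT; apply: contrapT => nocol.
(* The point that [f] sends to the origin, where every row form is 0 rather than 1. *)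
pose x' := - (invmx f.1 *m f.2).
have fx' : affmap_fun f x' = 0.
  by rewrite /affmap_fun mulmxN mulmxA mulmxV// mul1mx addNr.
pose z' : 'M[R]_(2, m) * 'M[R]_(n, 2) :=
  (\matrix_(k, l) (if l == e.2 then x' k 0 else M k l), M').
(* Genericity in contrapositive form: dependence at [z] means dependence at every pair. *)
have dT' : ~ indep z' T by move=> iT'; apply: dT; apply: z_generic; exists z'.
have colE e1 : e1 \in T :\ e -> col e1.2 z'.1 = col e1.2 M.
  move=> e1T; apply/colP => k; rewrite !mxE; case: eqP => // e12.
  by case: nocol; exists e1.
have incE e1 : e1 \in T :\ e -> incidence z' e1 = incidence z e1.
  move=> /colE ce; have cE k : z'.1 k e1.2 = M k e1.2.
    by have := congr1 (fun x : 'cV[R]_2 => x k 0) ce; rewrite !mxE.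
  by rewrite /incidence !cE.
apply: dT'; apply/indepP => c cs.
(* At [f] the term of [e] is zero and the others equal their coefficients, so these add up to zero;
   so do all coefficients together. *)
have ce : c e = 0.
  have [cf c0] := (incidence_sum0 z' T c).1 cs.
  have := cf f; rewrite (big_setD1 e)//= homformE.
  have -> : col e.2 z'.1 = x' by apply/colP => k; rewrite !mxE eqxx.
  rewrite fx' linear0 mulr0 add0r => cfD.
  move: c0; rewrite (big_setD1 e)//=.
  suff -> : \sum_(e1 in T :\ e) c e1 = 0 by rewrite addr0.
  rewrite -[RHS]cfD; apply: eq_bigr => e1 e1T.
  rewrite homformE colE// -[dotp _ _]/(homform z e1 f) tT ?mulr1//.
  by move: e1T; rewrite in_setD1 => /andP[].
move=> e1 e1T; have [->//|e1e] := eqVneq e1 e.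
apply: ((indepP z (T :\ e)).1 iT c) => //; last by rewrite in_setD1 e1e.
rewrite -[RHS]cs [in RHS](big_setD1 e)//= ce scale0r add0r.
by apply: eq_bigr => e2 e2T; rewrite incE.
Qed.

Lemma tight_indep (T : {set E}) : tight T -> indep z T.
Proof.
(* Induction on the size allows [T] to be minimal: dropping any incidence leaves an independent
   set. *)
move: {2}#|T|.+1 (ltnSn #|T|) => N; elim: N T => // N IH T TN tT.
apply: contrapT => dT.
have iD e : e \in T -> indep z (T :\ e).
  move=> eT; apply: IH; last by move=> e1; rewrite in_setD1 => /andP[_ /tT].
  by move: TN; rewrite (cardsD1 e T) eT.
have [c [cs [e0 e0T ce0]]] : exists c : E -> R,
    \sum_(e in T) c e *: incidence z e = 0 /\ exists2 e, e \in T & c e != 0.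
  apply: contrapT => nc; apply: dT; apply/indepP => c cs e eT.
  by apply/eqP; apply: contrapT => /negP ce; apply: nc; exists c; split=> //; exists e.
have [cf c0] := (incidence_sum0 z T c).1 cs.
have T7 : (#|T| <= 7)%N.
  rewrite (cardsD1 e0 T) e0T add1n ltnS; apply: tight_indep_card (iD _ e0T).
  by move=> e1; rewrite in_setD1 => /andP[_ /tT].
pose J := (fun e : E => e.2) @: T.
(* Each column in [J] occurs at least twice in [T], so twice [#|J|] is at most 7. *)
have J3 : (#|J| <= 3)%N.
  rewrite -ltnS -(@ltn_pmul2r 2)// (leq_ltn_trans _ (T7 : (_ < 8)%N))//.
  rewrite -[X in (_ <= X)%N]sum1_card (partition_big (fun e => e.2) (mem J))/=; last first.
    by move=> e eT; apply/imsetP; exists e.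
  rewrite -sum_nat_const; apply: leq_sum => _ /imsetP[e eT ->].
  have [e' e'T e'e] := minimal_dep_column tT dT eT (iD _ eT).
  move: e'T; rewrite in_setD1 => /andP[e'Ne e'T].
  by rewrite (bigD1 e) ?eT ?eqxx//= (bigD1 e')/= ?e'T ?e'e ?eqxx.
have [|u [r [ur uJ]]] := @exposed_separate _ _ _ p J e0.2 hp.
  have e0J : e0.2 \in J by apply/imsetP; exists e0.
  by move: J3; rewrite (cardsD1 e0.2) e0J.
(* The relation is applied to the affine map that sends [x] to [(dotp u x - r) *: y], which kills
   the other columns of [J]. *)
have col0 y : \sum_(e in T | e.2 == e0.2) c e * rowform M' e.1 y = 0.
  have := cf (y *m u, - r *: y).
  rewrite (bigID (fun e => e.2 == e0.2))/= [X in _ + X]big1; last first.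
    move=> e /andP[eT ee0]; rewrite homformE /affmap_fun/= -mulmxA.
    rewrite [u *m _]mx11_scalar -[(u *m _) 0 0]/(dotp u _) uJ; last first.
      by rewrite in_setD1 ee0; apply/imsetP; exists e.
    by rewrite mul_mx_scalar -scalerDl subrr scale0r linear0 mulr0.
  rewrite addr0 => h; apply: (mulfI (_ : dotp u (col e0.2 M) - r != 0)).
    by rewrite subr_eq0.
  rewrite mulr0 -[RHS]h mulr_sumr; apply: eq_bigr => e /andP[_ /eqP ee0].
  rewrite homformE /affmap_fun/= -mulmxA ee0.
  rewrite [u *m _]mx11_scalar -[(u *m _) 0 0]/(dotp u _).
  by rewrite mul_mx_scalar -scalerDl linearZ/= mulrCA.
have [e1 e1T e1e0] := minimal_dep_column tT dT e0T (iD _ e0T).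
move: e1T; rewrite in_setD1 => /andP[e1Ne0 e1T].
have fst_neq (a b : E) : a.2 = b.2 -> a != b -> a.1 != b.1.
  move=> ab; apply: contraNneq => ab'.
  by rewrite [a]surjective_pairing ab ab' -surjective_pairing.
pose q := affmap_fun f (col e0.2 M).
have tq e : e \in T -> e.2 = e0.2 -> rowform M' e.1 q = 1.
  by move=> eT ee0; rewrite -(tT e eT) homformE ee0.
(* A third incidence at this column would put three lines through [q]. *)
have two y : c e0 * rowform M' e0.1 y + c e1 * rowform M' e1.1 y = 0.
  rewrite -[RHS](col0 y) (bigD1 e0) ?e0T ?eqxx//=.
  rewrite (bigD1 e1) ?e1T ?e1e0 ?eqxx//= big1 ?addr0// => e.
  move=> /andP[/andP[/andP[eT /eqP ee0] eNe0] eNe1]; exfalso.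
  apply: (@no_three_concurrent _ _ M' p' q e0.1 e1.1 e.1) => //; try exact: tq.
  - by apply: fst_neq; rewrite // eq_sym.
  - by apply: fst_neq; rewrite // eq_sym.
  - by apply: fst_neq; rewrite ?e1e0// eq_sym.
(* At [q] both forms equal 1, so the coefficients are opposite; at [p' e0.1] the forms differ, which
   forces [c e0 = 0]. *)
have := two q; rewrite !tq// !mulr1 => c01.
have := two (p' e0.1); have [p1 /(_ e1.1 (fst_neq _ _ e1e0 e1Ne0)) lt1] := hp' e0.1.
rewrite p1 mulr1 (_ : c e1 = - c e0); last by lra.
move=> /eqP; rewrite mulNr -[X in X - _]mulr1 -mulrBr mulf_eq0 (negPf ce0)/=.
by rewrite subr_eq0 gt_eqF.
Qed.

End TightIndependent.

(** * From rank two to simple vertices *)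

(** A row annihilating the linear part of [f] is orthogonal to differences of image points, which
    span the plane. *)
Lemma map_rank2_unit (R : realType) (P : set 'cV[R]_2) (f : affmap R) :
  map_rank P f 2 -> f.1 \in unitmx.
Proof.
move=> [_ [s [[x0 Px0 <-] fs Ps _]]].
rewrite -row_free_unit; apply: inj_row_free => u uA.
have us i : dotp u (tnth s i) = 0.
  have [x Px xE] := Ps i.
  have -> : tnth s i = f.1 *m (x - x0).
    apply: (addrI (affmap_fun f x0)); rewrite -xE /affmap_fun mulmxBr.
    by rewrite addrAC addrCA subrr addr0.
  by rewrite /dotp mulmxA uA mul0mx mxE.
have u0 x : dotp u x = 0.
  rewrite (coord_span (free_pair_span x fs)) linear_sum/= big1// => i _.
  by rewrite linearZ/= -tnth_nth us mulr0.
apply: rV2P; rewrite mxE.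
  by have := u0 (delta_mx 0 0); rewrite dotpE !mxE/= mulr1 mulr0 addr0.
by have := u0 (delta_mx 1 0); rewrite dotpE !mxE/= mulr1 mulr0 add0r.
Qed.

Theorem theorem6p1 (R : realType) (m n : nat) (hm : (3 <= m)%N) (hn : (3 <= n)%N) :
  exists U : set ('M[R]_(2, m) * 'M[R]_(n, 2)),
    dense_open_subset (@R2 R m `*` @R2' R n) U /\
    forall (M : 'M[R]_(2, m)) (M' : 'M[R]_(n, 2)), U (M, M') ->
    forall f : affmap R,
      vertex_map (Ppoly M) (Qpoly M') f -> map_rank (Ppoly M) f 2 ->
      simple_vertex 6 (aff_hom (Ppoly M) (Qpoly M')) f.
Proof.
have [go gd] := generic_open_dense R m n.
exists ((@R2 R m `*` @R2' R n) `&` @generic R m n); split.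
  split; [exact: subIsetl|by exists (@generic R m n)|].
  move=> z Dz B; rewrite nbhsE => -[A [oA Az] AB].
  (* As the domain is itself open, its trace on a neighbourhood is an open set that the dense set
     meets. *)
  have Dopen : open (@R2 R m `*` @R2' R n).
    rewrite -[X in open X]/(fst @^-1` (@R2 R m) `&` snd @^-1` (@R2' R n)).
    apply: openI; apply: open_comp; do ?[exact: R2_open|exact: R2'_open].
      by move=> x _; exact: cvg_fst.
    by move=> x _; exact: cvg_snd.
  have [||y [[Ay Dy] gy]] := gd (A `&` (@R2 R m `*` @R2' R n)).
  - by exists z.
  - exact: openI.
  by exists y; split; [split|exact: AB].
move=> M M' [[/= RM RM'] gz] f; rewrite /vertex_map aff_homE => vf rf.
have [p hp] := R2_exposed RM; have [p' hp'] := R2'_exposed RM'.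
pose T := tight_set (homform (M, M')) f.
have tT e : e \in T -> homform (M, M') e f = 1 by rewrite inE => /eqP.
have iT : indep (M, M') T.
  by apply: (tight_indep hp hp' gz (map_rank2_unit rf)).
have Tker x : (forall a : 'I_#|T|, homform (M, M') (enum_val a) x = 0) -> x = 0.
  move=> hx; apply: (hpoly_vertex_kernel vf) => e /eqP ef.
  have eT : e \in T by rewrite inE.
  by rewrite -(enum_rankK_in eT eT).
have Tindep (c : 'I_#|T| -> R) :
    (forall x, \sum_a c a * homform (M, M') (enum_val a) x = 0) -> forall a, c a = 0.
  move=> hc a.
  pose c' e := c (enum_rank_in (enum_valP a) e).
  have c'E k : c' (enum_val k) = c k by rewrite /c' enum_valK_in.
  rewrite -c'E; apply: ((indepP (M, M') T).1 iT c') (enum_valP a).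
  have hf g : \sum_(e in T) c' e * homform (M, M') e g = 0.
    rewrite big_enum_val/= -[RHS](hc g).
    by apply: eq_bigr => k _; rewrite c'E.
  (* All forms equal 1 at [f], so a relation among them also has coefficients of zero sum. *)
  apply/incidence_sum0; split=> //.
  by rewrite -[RHS](hf f); apply: eq_bigr => e /tT ->; rewrite mulr1.
have [dE [d hd]] := dual_basis Tker Tindep.
(* Four matrix entries and two translation entries give the space of affine maps dimension 6. *)
have -> : (6 = #|T|)%N by rewrite -dE.
apply: (simple_vertex_of_dual (e := enum_val) (d := d)) => // e; split.
  move=> /eqP ef; have eT : e \in T by rewrite inE.
  by exists (enum_rank_in eT e); rewrite enum_rankK_in.
by move=> [a <-]; apply: tT; exact: enum_valP.
Qed.
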